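(* Let $a\ge 2b>0$ be constants and let $G(V,E)$ be generated according to $\mathrm{GBM}\big(r_s=\tfrac{a\log n}{n},\,r_d=\tfrac{b\log n}{n}\big)$. Define $$t_1=\min\{t:(2b+t)\log\tfrac{2b+t}{2b}-t>1\},\qquad t_2=\min\{t:(2b-t)\log\tfrac{2b-t}{2b}+t>1\},$$ $$\theta_1=\max\Big\{\theta:\tfrac12\Big((4b+2t_1)\log\tfrac{4b+2t_1}{2a-\theta}+2a-\theta-4b-2t_1\Big)>1\text{ and }0\le\theta\le 2a-4b-2t_1\Big\},$$ $$\theta_2=\min\Big\{\theta:\tfrac12\Big((4b-2t_2)\log\tfrac{4b-2t_2}{2a-\theta}+2a-\theta-4b+2t_2\Big)>1\text{ and }a\ge\theta\ge\max\{2b,\,2a-4b+2t_2\}\Big\}.$$ Then there exists an efficient (polynomial-time) algorithm which, given $G$ (and the parameters $a,b$), recovers the correct partition $\{V_1,V_2\}$ with probability $1-o(1)$ if $a-\theta_2+\theta_1>2$, or if $a-\theta_2>1$ and $a>2$.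
   Context: Geometric block model $\mathrm{GBM}(r_s,r_d)$ with $r_s>r_d$: the vertex set is $V=V_1\sqcup V_2$ with $|V_1|=|V_2|=n/2$ (the partition is hidden). Each $u\in V$ receives an independent uniform random number $X_u\in[0,1]$. Vertices $u,v$ are adjacent if and only if $d_L(X_u,X_v)\le r_s$ when $u,v$ lie in the same part, and $d_L(X_u,X_v)\le r_d$ when they lie in different parts, where $d_L(x,y)=\min\{|x-y|,1-|x-y|\}$. Recovering the partition means outputting $\{V_1,V_2\}$ exactly (up to swapping the two labels) from the graph alone. $\log$ is the natural logarithm.
   Formalization: The min and max, over sets cut out by strict inequalities, are read as inf and sup; t ranges over t≥0 (and t≤2b for t_2), since otherwise the set for t_2 is unbounded below and has no minimum; when the sets are empty, t_2=2b, θ_1=0 and θ_2=a. *)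

(* Defs.v *)
From mathcomp Require Import all_boot all_order all_algebra.
From mathcomp Require Import all_classical all_reals all_analysis.

Set Implicit Arguments.
Unset Strict Implicit.
Unset Printing Implicit Defensive.

Import Order.TTheory GRing.Theory Num.Theory.
Import numFieldNormedType.Exports.

(* Model of computation: random access machine in the style of Cook and
   Reckhow, with structured control flow and unit cost per operation.  The only
   arithmetic is addition and truncated subtraction: since there is no
   multiplication, t steps can only lengthen numbers by O(t) bits, so that
   polynomial time here is polynomial time on Turing machines. *)

Definition memory := nat -> nat.

Inductive expr :=
| Const of nat
| Read of expr (* content of the cell whose address is given *)
| Add of expr & expr
| Sub of expr & expr.

Inductive program :=
| Skip
| Write of expr & expr (* [Write x y] stores y in the cell with address x *)
| Seq of program & program
| If of expr & program & program
| While of expr & program.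

Fixpoint value (m : memory) (x : expr) : nat :=
  match x with
  | Const k => k
  | Read y => m (value m y)
  | Add y z => value m y + value m z
  | Sub y z => value m y - value m z
  end.

Fixpoint cost (x : expr) : nat :=
  match x with
  | Const _ => 1
  | Read y => (cost y).+1
  | Add y z | Sub y z => (cost y + cost z).+1
  end.

(* [exec p m m' t]: started in memory m, p halts in memory m' after t steps.
   Tests succeed on nonzero values. *)
Inductive exec : program -> memory -> memory -> nat -> Prop :=
| ExecSkip m : exec Skip m m 1
| ExecWrite m x y :
    exec (Write x y) m [eta m with value m x |-> value m y]
         (cost x + cost y).+1
| ExecSeq p q m m' m'' t t' :
    exec p m m' t -> exec q m' m'' t' -> exec (Seq p q) m m'' (t + t').+1
| ExecIfTrue x p q m m' t :
    value m x != 0 -> exec p m m' t -> exec (If x p q) m m' (cost x + t).+1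
| ExecIfFalse x p q m m' t :
    value m x = 0 -> exec q m m' t -> exec (If x p q) m m' (cost x + t).+1
| ExecWhileTrue x p m m' m'' t t' :
    value m x != 0 -> exec p m m' t -> exec (While x p) m' m'' t' ->
    exec (While x p) m m'' (cost x + t + t').+1
| ExecWhileFalse x p m :
    value m x = 0 -> exec (While x p) m m (cost x).+1.

(* Input: cell 0 holds the number n of vertices, cell 1 + n * i + j holds the
   adjacency bit of (i, j), and all the other cells hold 0. *)
Definition input n (e : rel 'I_n) : memory := fun k =>
  if k is k'.+1 then
    [exists i : 'I_n, exists j : 'I_n, (k' == n * i + j) && e i j] : nat
  else n.

Definition simple_graph n (e : rel 'I_n) := symmetric e /\ irreflexive e.

Definition polynomial_time (p : program) :=
  exists C k : nat, forall (n : nat) (e : rel 'I_n), simple_graph e ->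
    exists m t, exec p (input e) m t /\ t <= C * n.+1 ^ k.

(* Output: vertex i belongs to the first part iff cell i holds a nonzero
   value. *)
Definition recovers (p : program) n (e : rel 'I_n) (V1 : {set 'I_n}) :=
  exists m t, exec p (input e) m t /\
    let S := [set i : 'I_n | m i != 0]%SET in S = V1 \/ S = (~: V1)%SET.

Local Open Scope classical_set_scope.
Local Open Scope ring_scope.

Section GeometricBlockModel.
Context {R : realType}.

Definition dL (x y : R) : R := Num.min `|x - y| (1 - `|x - y|).

(* The two parts are V1 and its complement, x u is the position of u. *)
Definition gbm n (V1 : {set 'I_n}) (rs rd : R) (x : 'I_n -> R) : rel 'I_n :=
  fun u v => (u != v) &&
    (dL (x u) (x v) <= if (u \in V1) == (v \in V1) then rs else rd).

Definition independent_RVs d (T : measurableType d) (P : probability T R)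
    (I : finType) (X : I -> {RV P >-> R}) :=
  forall (J : {set I}) (B : I -> set R), (forall i, measurable (B i)) ->
    P [set w | forall i, i \in J -> B i (X i w)] =
    (\prod_(i in J) fine (P (X i @^-1` B i)))%:E.

Definition iid_uniform01 d (T : measurableType d) (P : probability T R)
    (I : finType) (X : I -> {RV P >-> R}) :=
  independent_RVs X /\
  forall i (B : set R), measurable B ->
    distribution P (X i) B = uniform_prob (@ltr01 R) B.

(* The minima and maxima below are over sets cut out by strict inequalities,
   hence are infima and suprema.  t is the size of a deviation above (t1) or
   below (t2) a mean 2b, so it is nonnegative, and at most 2b in t2.
   Each of t2, theta1, theta2 is taken inside the range of its variable, so that
   over an empty set it is the corresponding endpoint of the range; this endpoint
   is adjoined explicitly, which changes nothing when the set is nonempty.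
   - If 2b <= 1, there is no admissible t and t2 = 2b; the set defining theta2
     is then empty too.
   - If there is no admissible theta, [0, theta1] shrinks to [0, 0], resp.
     [theta2, a] shrinks to [a, a]. *)

Definition t1 (b : R) : R :=
  inf [set t | 0 <= t /\ (2 * b + t) * ln ((2 * b + t) / (2 * b)) - t > 1].

Definition t2 (b : R) : R :=
  inf ([set t | 0 <= t <= 2 * b /\
                (2 * b - t) * ln ((2 * b - t) / (2 * b)) + t > 1]
       `|` [set 2 * b]).

Definition theta1 (a b : R) : R :=
  sup ([set theta |
         2^-1 * ((4 * b + 2 * t1 b) *
                   ln ((4 * b + 2 * t1 b) / (2 * a - theta))
                 + 2 * a - theta - 4 * b - 2 * t1 b) > 1 /\
         0 <= theta <= 2 * a - 4 * b - 2 * t1 b]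
       `|` [set 0]).

Definition theta2 (a b : R) : R :=
  inf ([set theta |
         2^-1 * ((4 * b - 2 * t2 b) *
                   ln ((4 * b - 2 * t2 b) / (2 * a - theta))
                 + 2 * a - theta - 4 * b + 2 * t2 b) > 1 /\
         Num.max (2 * b) (2 * a - 4 * b + 2 * t2 b) <= theta <= a]
       `|` [set a]).

End GeometricBlockModel.

(* Main.v *)
(** An edge (u, v) is certified when its number of common neighbours leaves a
    window around 2b log n.  An edge between the two parts has about 2b log n
    common neighbours whatever its length; an edge of length theta log n / n inside
    a part has about (a - theta / 2) log n if theta >= 2b, and at least that many
    otherwise.  By the choice of t1, t2, theta1, theta2, no edge between the parts
    is certified, and all edges inside a part with theta <= theta1 or
    theta >= theta2 are.  The program labels the component of vertex 0 in the graph
    of certified edges.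

    The circle is cut into about M n / log n cells, M a large constant, and all
    that is used of the positions is the cell of each vertex; these form a uniform
    random function, so that probabilities become proportions of functions.  By
    Chernoff's bound and a union bound over the cells i and over the subsets J of a
    window of constantly many cells starting at i, the number of vertices in J is
    close to its mean, up to the deviations of probability n^-1.  In particular,
    fewer than 2(1 + eta) M cells of a window contain no vertex of a given part.

    This makes the certified edges connect each part, deterministically.  Every
    window contains long stretches of cells without an empty cell, and each stretch
    is connected.  If a component of the points between two stretches avoids the
    right one, all cells at certified distance to the right of its last point are
    empty, and symmetrically on the left.  If a - theta2 + theta1 > 2 one side
    already gives too many empty cells; if a - theta2 > 1 and a > 2, both sides
    together do, or else there is a gap of length more than a > 2. *)

Require Import Defs.
From mathcomp Require Import all_boot all_order all_algebra.
From mathcomp Require Import all_classical all_reals all_analysis.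
From mathcomp Require Import zify ring lra.

Set Implicit Arguments.
Unset Strict Implicit.
Unset Printing Implicit Defensive.

Import Order.TTheory GRing.Theory Num.Theory.
Import numFieldNormedType.Exports.

(** * Programs *)

(** Termination is part of the assertion: this is a total-correctness triple with a bound on the
    running time. *)
Definition runs p m (Q : memory -> Prop) T :=
  exists m' t, [/\ exec p m m' t, Q m' & t <= T].

Lemma runs_weaken p m (Q Q' : memory -> Prop) T T' :
  (forall m', Q m' -> Q' m') -> T <= T' -> runs p m Q T -> runs p m Q' T'.
Proof.
move=> QQ' TT' [m' [t [pm Qm tT]]]; exists m', t; split => //; first exact: QQ'.
exact: leq_trans tT TT'.
Qed.

Lemma runs_seq p q m (Q Q' : memory -> Prop) T T' :
  runs p m Q T -> (forall m', Q m' -> runs q m' Q' T') ->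
  runs (Seq p q) m Q' (T + T').+1.
Proof.
move=> [m' [t [pm Qm tT]]] /(_ _ Qm) [m'' [t' [qm Qm' tT']]].
by exists m'', (t + t').+1; split=> //; [exact: ExecSeq pm qm | lia].
Qed.

Lemma runs_skip m (Q : memory -> Prop) T : Q m -> 0 < T -> runs Skip m Q T.
Proof. by move=> Qm T0; exists m, 1; split=> //; constructor. Qed.

Lemma runs_write m x y (Q : memory -> Prop) :
  Q [eta m with value m x |-> value m y] ->
  runs (Write x y) m Q (cost x + cost y).+1.
Proof.
by move=> Qm; eexists _, _; split; [exact: ExecWrite | exact: Qm |].
Qed.

Lemma runs_if x p q m (Q : memory -> Prop) T :
  runs (if value m x != 0 then p else q) m Q T ->
  runs (If x p q) m Q (cost x + T).+1.
Proof.
case: ifPn => [x1|/negbNE/eqP x0] [m' [t [pm Qm tT]]];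
  exists m', (cost x + t).+1; split => //; try lia.
  exact: ExecIfTrue.
exact: ExecIfFalse.
Qed.

(** The loop makes exactly [N] turns, because the indexed invariant decides the test at each turn;
    induction on the number [d] of remaining turns. *)
Lemma runs_while x p N (I : nat -> memory -> Prop) m T :
  (forall k m', k < N -> I k m' -> value m' x != 0 /\ runs p m' (I k.+1) T) ->
  (forall m', I N m' -> value m' x = 0) ->
  I 0 m -> runs (While x p) m (I N) ((cost x + T).+1 * N.+1).
Proof.
move=> body stop.
suff H d k m' : k + d = N -> I k m' ->
    runs (While x p) m' (I N) ((cost x + T).+1 * d.+1) by exact: H.
elim: d k m' => [|d IH] k m'.
  rewrite addn0 => -> Im; exists m', (cost x).+1; split => //; last lia.
  by apply: ExecWhileFalse; exact: stop.
move=> kd Im; have [|x1 [m1 [t1 [pm I1 t1T]]]] := body _ _ _ Im; first by lia.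
have [|m2 [t2 [pm2 I2 t2T]]] := IH _ _ _ I1; first by lia.
exists m2, (cost x + t1 + t2).+1; split=> //; first exact: ExecWhileTrue pm pm2.
by rewrite mulnS; lia.
Qed.

(* Cells up to [B] hold [low], the next fifteen hold the variables and the others
   the labels.  Cell 1, the unused entry (0, 0) of the matrix, holds [B]. *)
Definition store (low : memory) (B : nat) (vars : seq nat) (lab : memory) :
    memory := fun k =>
  if k <= B then low k else if k < B + 16 then nth 0 vars (k - B.+1)
  else lab (k - (B + 16)).
Arguments store : simpl never.

(** A program is a fixed text while [B] grows with n, so every address above the matrix is computed
    at run time from the copy of [B] in cell 1. *)
Definition var_addr k := Add (Read (Const 1)) (Const k.+1).
Definition fetch k := Read (var_addr k).
Definition set_var k x := Write (var_addr k) x.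
Definition lab_addr x := Add (Add (Read (Const 1)) (Const 16)) x.
Definition get_lab x := Read (lab_addr x).
Definition num_vertices := Read (Const 0).
Definition incr k := set_var k (Add (fetch k) (Const 1)).
Definition for_loop k p :=
  Seq (set_var k (Const 0))
      (While (Defs.Sub num_vertices (fetch k)) (Seq p (incr k))).
(** Multiplication by a constant, unrolled into additions since the machine has no product. *)
Fixpoint scale q x := if q is q'.+1 then Add x (scale q' x) else Const 0.

Lemma value_scale q x m : value m (scale q x) = q * value m x.
Proof. by elim: q => //= q ->; rewrite mulSn. Qed.

Section Store.
Variables (n B : nat) (low : memory).
Hypothesis B_gt0 : 0 < B.
Hypothesis low0 : low 0 = n.
Hypothesis low1 : low 1 = B.
Local Notation st := (store low B).

Lemma store_low vars lab k : k <= B -> st vars lab k = low k.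
Proof. by rewrite /store => ->. Qed.

Lemma value_num_vertices vars lab : value (st vars lab) num_vertices = n.
Proof. by rewrite /= store_low. Qed.

Lemma value_var_addr vars lab k :
  value (st vars lab) (var_addr k) = B + k.+1.
Proof. by rewrite /= store_low // low1. Qed.

Lemma value_fetch vars lab k : k < 15 ->
  value (st vars lab) (fetch k) = nth 0 vars k.
Proof.
Proof.
move=> k15; rewrite -[LHS]/(st vars lab (value _ (var_addr k))).
rewrite value_var_addr /store ifF; last by lia.
by rewrite ifT; [congr nth|]; lia.
Qed.

Lemma value_lab_addr vars lab x :
  value (st vars lab) (lab_addr x) = B + 16 + value (st vars lab) x.
Proof. by rewrite /= store_low // low1. Qed.

Lemma value_get_lab vars lab x :
  value (st vars lab) (get_lab x) = lab (value (st vars lab) x).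
Proof.
rewrite -[LHS]/(st vars lab (value _ (lab_addr x))) value_lab_addr /store.
by rewrite ifF ?ifF; [congr lab | |]; lia.
Qed.

Lemma store_set_var vars lab k x : k < 15 ->
  ([eta st vars lab with B + k.+1 |-> x] : memory) = st (set_nth 0 vars k x) lab.
Proof.
move=> k15; apply/funext => i /=; rewrite /store nth_set_nth /=.
have [->|ik] := eqVneq i (B + k.+1).
  rewrite ifF; last lia.
  by rewrite ifT ?ifT //; lia.
by case: leqP => // iB; case: ltnP => // iB'; rewrite ifF //; lia.
Qed.

Lemma store_set_lab vars lab j x :
  ([eta st vars lab with B + 16 + j |-> x] : memory) =
  st vars [eta lab with j |-> x].
Proof.
apply/funext => i /=; rewrite /store.
have [->|ik] := eqVneq i (B + 16 + j).
  rewrite ifF; last lia.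
  by rewrite ifF ?addKn /= ?eqxx //; lia.
by case: leqP => // iB; case: ltnP => // iB' /=; rewrite ifF //; lia.
Qed.

Lemma runs_set_var vars lab k x (Q : memory -> Prop) : k < 15 ->
  Q (st (set_nth 0 vars k (value (st vars lab) x)) lab) ->
  runs (set_var k x) (st vars lab) Q (cost x + 5).
Proof.
move=> k15 Qm; apply: (@runs_weaken _ _ Q Q) (runs_write _) => //.
  by rewrite /=; lia.
by rewrite value_var_addr store_set_var.
Qed.

Lemma runs_incr vars lab k (Q : memory -> Prop) : k < 15 ->
  Q (st (set_nth 0 vars k (nth 0 vars k).+1) lab) ->
  runs (incr k) (st vars lab) Q 12.
Proof.
move=> k15 Qm; apply: runs_weaken (runs_set_var _ _) => //.
  by move=> ? H; exact: H.
by rewrite [value _ _]/= -/(fetch k) -[X in X + 1]/(value _ (fetch k)) value_fetch // addn1.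
Qed.

(** The body must leave the counter as it found it. [I] is stated for the variables with the counter
    already updated, so that it may pin down the whole list. *)
Lemma runs_for k p (I : nat -> seq nat -> memory -> Prop) vars lab T :
  k < 15 ->
  (forall j vars' lab', j < n -> nth 0 vars' k = j -> I j vars' lab' ->
     runs p (st vars' lab')
       (fun m => exists v l, [/\ m = st v l, nth 0 v k = j &
                    I j.+1 (set_nth 0 v k j.+1) l]) T) ->
  I 0 (set_nth 0 vars k 0) lab ->
  runs (for_loop k p) (st vars lab)
    (fun m => exists v l, [/\ m = st v l, nth 0 v k = n & I n v l])
    ((T + 30) * n.+1 + 7).
Proof.
move=> k15 body I0.
pose Q j m := exists v l, [/\ m = st v l, nth 0 v k = j & I j v l].
apply: (@runs_weaken _ _ (Q n) _ (6 + (8 + (T + 12).+1).+1 * n.+1).+1) => //.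
  by rewrite !mulnDl !mulSn; lia.
apply: (runs_seq (Q := Q 0)).
  apply: runs_set_var => //; exists (set_nth 0 vars k 0), lab; split => //.
  by rewrite nth_set_nth /= eqxx.
move=> m Q0; apply: runs_while Q0.
  move=> j _ jn [v [l [-> vj Il]]]; split.
    by rewrite -[value _ _]/(value _ num_vertices - value _ (fetch k))
      value_num_vertices value_fetch // vj; lia.
  apply: runs_seq; first exact: body jn vj Il.
  move=> m' [v' [l' [-> v'j Il']]]; apply: runs_incr => //.
  rewrite v'j; exists (set_nth 0 v' k j.+1), l'; split=> //.
  by rewrite nth_set_nth /= eqxx.
move=> m' [v [l [-> vj Il]]].
by rewrite -[value _ _]/(value _ num_vertices - value _ (fetch k))
      value_num_vertices value_fetch // vj; lia.
Qed.

End Store.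

(** Variables 0 to 8 hold the round, u, n * u, v, n * v, w, the count, [up_log 2 n] and a power of
    two. The row offsets n * u and n * v are maintained by adding n. *)
Definition count_body :=
  If (Read (Add (Add (Const 1) (fetch 2)) (fetch 5)))
     (If (Read (Add (Add (Const 1) (fetch 4)) (fetch 5))) (incr 6) Skip) Skip.
Definition count_common := Seq (set_var 6 (Const 0)) (for_loop 5 count_body).

(** * Propagation of labels along certified edges *)

Section Propagation.
Variables p1 q1 p2 q2 : nat.

(** A sum of truncated differences is nonzero iff one of them is positive: this encodes the
    disjunction in [certified]. *)
Definition test := Add (Defs.Sub (scale q1 (fetch 6)) (scale p1 (fetch 7)))
                       (Defs.Sub (scale p2 (fetch 7)) (scale q2 (fetch 6))).
Definition edge_body :=
  Seq count_common
    (Seq (If (Read (Add (Add (Const 1) (fetch 2)) (fetch 3)))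
           (If (get_lab (fetch 1))
             (If test (Write (lab_addr (fetch 3)) (Const 1)) Skip) Skip) Skip)
         (set_var 4 (Add (fetch 4) num_vertices))).
Definition vertex_body :=
  Seq (set_var 4 (Const 0))
    (Seq (for_loop 3 edge_body) (set_var 2 (Add (fetch 2) num_vertices))).
Definition round_body :=
  Seq (set_var 2 (Const 0)) (for_loop 1 vertex_body).
Definition propagate := for_loop 0 round_body.

Variables (n B : nat) (low : memory).
Hypothesis B_gt : n * n < B.
Hypothesis low0 : low 0 = n.
Hypothesis low1 : low 1 = B.
Local Notation st := (store low B).

Let B_gt0 : 0 < B. Proof. by lia. Qed.

Definition adj x y := low (1 + n * x + y) != 0.
Definition common x y k := count (fun w => adj x w && adj y w) (iota 0 k).

Lemma commonS x y k : common x y k.+1 = common x y k + (adj x k && adj y k).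
Proof. by rewrite /common -addn1 iotaD count_cat /= add0n addn0. Qed.

Let v_get vars lab k k15 := @value_fetch n B low B_gt0 low0 low1 vars lab k k15.

Lemma value_adj vars lab i j x y : x < n -> y < n ->
  nth 0 vars i = n * x -> nth 0 vars j = y -> i < 15 -> j < 15 -> 
  value (st vars lab) (Read (Add (Add (Const 1) (fetch i)) (fetch j))) =
  low (1 + n * x + y).
Proof.
move=> xn yn vi vj i15 j15.
rewrite -[LHS]/(st vars lab (1 + value _ (fetch i) + value _ (fetch j))).
by rewrite !v_get // vi vj store_low //; nia.
Qed.

Lemma runs_count r u v w c L pw lab : u < n -> v < n ->
  runs count_common (st [:: r; u; n * u; v; n * v; w; c; L; pw] lab)
    (fun m => m = st [:: r; u; n * u; v; n * v; n; common u v n; L; pw] lab)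
    (100 * n.+1).
Proof.
move=> un vn.
apply: (@runs_weaken _ _ (fun m => exists vars l, [/\ m = st vars l, nth 0 vars 5 = n & 
  l = lab /\ vars = [:: r; u; n * u; v; n * v; n; common u v n; L; pw]])
   _ (6 + ((42 + 30) * n.+1 + 7)).+1).
- by move=> m [_ [_ [-> _ [-> ->]]]].
- lia.
apply: (@runs_seq _ _ _ (fun m => m = st [:: r; u; n * u; v; n * v; w; 0; L; pw] lab)).
  exact: runs_set_var.
move=> _ ->.
apply: (@runs_for n B low B_gt0 low0 low1 5 _ (fun j vars l => 
  l = lab /\ vars = [:: r; u; n * u; v; n * v; j; common u v j; L; pw])) => //.
move=> j _ _ jn _ [-> ->].
apply: (@runs_weaken _ _
  (fun m => m = st [:: r; u; n * u; v; n * v; j; common u v j.+1; L; pw] lab) _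
  (14 + (14 + 12).+1).+1) => //.
  by move=> _ ->; eexists _, _.
apply: runs_if.
rewrite (@value_adj _ _ _ _ u j) // -/(adj u j) commonS.
case: (adj u j); last first.
  by rewrite addn0; apply: runs_skip.
apply: runs_if.
rewrite (@value_adj _ _ _ _ v j) // -/(adj v j).
case: (adj v j); last first.
  by rewrite addn0; apply: runs_skip.
by rewrite addn1; apply: runs_incr.
Qed.


Definition certified x y := adj x y &&
  ((p1 * up_log 2 n < q1 * common x y n) || (q2 * common x y n < p2 * up_log 2 n)).

Fixpoint ball d x := if d is d'.+1 then
    ball d' x \/ exists y, [/\ y < n, ball d' y & certified y x] else x = 0.

(* The labels in the middle of round [d], when the edges (x, y) below (u, v) in
   lexicographic order have been processed. *)
Definition labelled d u v (lab : memory) := forall x, x < n ->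
  [/\ lab x != 0 -> exists d', ball d' x,
     ball d x -> lab x != 0 &
     ball d x -> forall y, y < n -> certified x y ->
       x < u \/ x = u /\ y < v -> lab y != 0].

(** Labels are updated in place, so a label may spread from a vertex labelled in the same round.
    This is why a labelled vertex is only claimed to lie in some ball, of unspecified radius. *)
Lemma labelled_set d u v (lab : memory) : u < n -> v < n ->
  certified u v -> lab u != 0 -> labelled d u v lab ->
  labelled d u v.+1 [eta lab with v |-> 1].
Proof.
move=> un vn cuv labu H x xn; have [H1 H2 H3] := H _ xn; split => /=.
- case: (x =P v) => [-> _|_ //]; have [/(_ labu)[d' bu] _ _] := H _ un.
  by exists d'.+1; right; exists u.
- by case: (x =P v) => // _.
- move=> bx y yn cxy xy; case: (y =P v) => // yv; apply: (H3 bx _ yn cxy).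
  by case: xy => [|[-> ?]]; [left | right; split=> //; lia].
Qed.

Lemma labelled_skip d u v (lab : memory) : u < n ->
  ~~ (certified u v && (lab u != 0)) -> labelled d u v lab ->
  labelled d u v.+1 lab.
Proof.
move=> un cuv H x xn; have [H1 H2 H3] := H _ xn; split => // bx y yn cxy xy.
case: (altP (x =P u)) => xu; last by apply: (H3 bx _ yn cxy); lia.
case: (altP (y =P v)) => yv; last by apply: (H3 bx _ yn cxy); lia.
by subst x y; rewrite cxy H2 in cuv.
Qed.

Lemma labelled_row d u lab : labelled d u n lab -> labelled d u.+1 0 lab.
Proof.
move=> H x xn; have [H1 H2 H3] := H _ xn; split => // bx y yn cxy xu.
by apply: (H3 bx y yn cxy); lia.
Qed.

Lemma labelled_round d lab : labelled d n 0 lab -> labelled d.+1 0 0 lab.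
Proof.
move=> H x xn; have [H1 H2 _] := H _ xn; split => //; last by move=> ? ? ? ?; lia.
case=> [/H2//|[y [yn by_ cyx]]]; have [_ _ H3] := H _ yn.
by apply: (H3 by_ x xn cyx); left.
Qed.

Let state r u pu v pv w c pw := [:: r; u; pu; v; pv; w; c; up_log 2 n; pw].

Lemma runs_edge r u v w c pw lab : u < n -> v < n -> labelled r u v lab ->
  runs edge_body (st (state r u (n * u) v (n * v) w c pw) lab)
    (fun m => exists l, labelled r u v.+1 l /\
       m = st (state r u (n * u) v (n * v.+1) n (common u v n) pw) l)
    ((200 + cost test) * n.+1).
Proof.
move=> un vn Hl.
apply: (@runs_weaken _ _ _ _
  (100 * n.+1 + ((14 + (11 + (cost test + 20).+1).+1).+1 + 13).+1).+1) => [? H| |].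
- exact: H.
- by rewrite mulnDl; lia.
apply: runs_seq; first exact: runs_count.
move=> _ ->.
pose c' := common u v n.
apply: (runs_seq (Q := fun m => exists l, labelled r u v.+1 l /\
       m = st (state r u (n * u) v (n * v) n c' pw) l)
    (T := (14 + (11 + (cost test + 20).+1).+1).+1)); last first.
  move=> _ [l [Hl' ->]]; apply: runs_set_var => //; exists l; split => //.
  rewrite -[value _ _]/(value _ (fetch 4) + value _ num_vertices).
  by rewrite v_get // (@value_num_vertices n B low low0) // mulnS addnC.
apply: runs_if; rewrite (@value_adj _ _ _ _ u v) // -/(adj u v).
have skip : ~~ (certified u v && (lab u != 0)) -> exists l, labelled r u v.+1 l /\
    st (state r u (n * u) v (n * v) n c' pw) lab =
    st (state r u (n * u) v (n * v) n c' pw) l.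
  by move=> H; exists lab; split => //; apply: labelled_skip.
rewrite /certified -/c' in skip.
move: skip; case auv : (adj u v) => /= skip; last first.
  by apply: runs_skip => //; exact: skip.
apply: runs_if; rewrite (@value_get_lab n B low B_gt0 low0 low1) // v_get // [nth _ _ _]/=.
case: ifPn => labu; last first.
  by apply: runs_skip => //; apply: skip; rewrite (negbTE labu) andbF.
apply: runs_if.
rewrite -[value _ test]/((value _ (scale q1 (fetch 6)) - value _ (scale p1 (fetch 7)))
  + (value _ (scale p2 (fetch 7)) - value _ (scale q2 (fetch 6)))).
rewrite !value_scale !v_get // [nth _ _ 6]/= [nth _ _ 7]/= -/c'.
case: ifPn => t0; last first.
  apply: runs_skip => //; apply: skip; rewrite labu andbT.
  by move: t0; lia.
apply: runs_weaken (runs_write _) => [m Q|//|].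
  exact: Q.
rewrite (@value_lab_addr B low B_gt0 low1) //.
rewrite (@store_set_lab n B low B_gt0 low0 low1) v_get //.
eexists; split; last by [].
apply: labelled_set => //.
by rewrite /certified auv -/c' /=; move: t0; lia.
Qed.

Lemma runs_vertex r u v pv w c pw lab : u < n -> labelled r u 0 lab ->
  runs vertex_body (st (state r u (n * u) v pv w c pw) lab)
    (fun m => exists l v pv w c, labelled r u.+1 0 l /\
       m = st (state r u (n * u.+1) v pv w c pw) l)
    ((300 + cost test) * n.+1 ^ 2).
Proof.
move=> un Hl; set C := cost test.
apply: (@runs_weaken _ _ _ _ (6 + (((200 + C) * n.+1 + 30) * n.+1 + 7 + 13).+1).+1)
  => [? H| |].
- exact: H.
- by rewrite -mulnn; nia.
apply: (runs_seq (Q := fun m => m = st (state r u (n * u) v 0 w c pw) lab)).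
  exact: runs_set_var.
move=> _ ->; pose I j vars l := labelled r u j l /\
  exists w c, vars = state r u (n * u) j (n * j) w c pw.
apply: runs_seq.
  apply: (@runs_for n B low B_gt0 low0 low1 3 edge_body I) => //.
    move=> j _ l jn _ [Hl' [w' [c' ->]]].
    apply: (runs_weaken _ (leqnn _) (runs_edge _ _ _ un jn Hl')).
    move=> _ [l' [Hl'' ->]]; eexists _, _; split; [reflexivity | by [] |].
    by split => //; eexists _, _.
  by split=> //; exists w, c; rewrite muln0.
move=> _ [_ [l [-> _ [Hl' [w' [c' ->]]]]]]; apply: runs_set_var => //.
exists l; eexists _, _, _, _; split; first exact: labelled_row.
rewrite -[value _ _]/(value _ (fetch 2) + value _ num_vertices).
by rewrite v_get // (@value_num_vertices n B low low0) // mulnS addnC.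
Qed.

Lemma runs_round r u pu v pv w c pw lab : labelled r 0 0 lab ->
  runs round_body (st (state r u pu v pv w c pw) lab)
    (fun m => exists l u pu v pv w c, labelled r.+1 0 0 l /\
       m = st (state r u pu v pv w c pw) l)
    ((400 + cost test) * n.+1 ^ 3).
Proof.
move=> Hl; set C := cost test.
apply: (@runs_weaken _ _ _ _ (6 + (((300 + C) * n.+1 ^ 2 + 30) * n.+1 + 7)).+1)
  => [? H| |].
- exact: H.
- rewrite (expnSr _ 2) mulnA; have := expn_gt0 n.+1 2; move: (n.+1 ^ 2) => N /= N0; nia.
apply: (runs_seq (Q := fun m => m = st (state r u 0 v pv w c pw) lab)).
  exact: runs_set_var.
move=> _ ->; pose I j vars l := labelled r j 0 l /\
  exists v pv w c, vars = state r j (n * j) v pv w c pw.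
apply: (@runs_weaken _ _ (fun m => exists v l, [/\ m = st v l, nth 0 v 1 = n & I n v l]) _
   (((300 + C) * n.+1 ^ 2 + 30) * n.+1 + 7)) => //.
  move=> _ [_ [l [-> _ [Hl' [v' [pv' [w' [c' ->]]]]]]]].
  by exists l; do 6 eexists; split; first exact: labelled_round.
apply: (@runs_for n B low B_gt0 low0 low1 1 vertex_body I) => //.
  move=> j _ l jn _ [Hl' [v' [pv' [w' [c' ->]]]]].
  apply: (runs_weaken _ (leqnn _) (runs_vertex _ _ _ _ _ jn Hl')).
  move=> _ [l' [v'' [pv'' [w'' [c'' [Hl'' ->]]]]]].
  eexists _, _; split; [reflexivity | by [] |].
  by split => //; do 4 eexists.
by split=> //; exists v, pv, w, c; rewrite muln0.
Qed.

Lemma runs_propagate r u pu v pv w c pw lab : labelled 0 0 0 lab ->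
  runs propagate (st (state r u pu v pv w c pw) lab)
    (fun m => exists vars l, labelled n 0 0 l /\ m = st vars l)
    ((500 + cost test) * n.+1 ^ 4).
Proof.
move=> Hl; set C := cost test.
pose I j vars l := labelled j 0 0 l /\
  exists u pu v pv w c, vars = state j u pu v pv w c pw.
apply: (@runs_weaken _ _ (fun m => exists v l, [/\ m = st v l, nth 0 v 0 = n & I n v l]) _
   (((400 + C) * n.+1 ^ 3 + 30) * n.+1 + 7)).
- by move=> _ [_ [l [-> _ [Hl' [u' [pu' [v' [pv' [w' [c' ->]]]]]]]]]]; eexists _, l.
- rewrite (expnSr _ 3) mulnA; have := expn_gt0 n.+1 3; move: (n.+1 ^ 3) => N /= N0; nia.
apply: (@runs_for n B low B_gt0 low0 low1 0 round_body I) => //.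
  move=> j _ l jn _ [Hl' [u' [pu' [v' [pv' [w' [c' ->]]]]]]].
  apply: (runs_weaken _ (leqnn _) (runs_round _ _ _ _ _ _ _ Hl')).
  move=> _ [l' [u'' [pu'' [v'' [pv'' [w'' [c'' [Hl'' ->]]]]]]]].
  eexists _, _; split; [reflexivity | by [] |].
  by split => //; do 6 eexists.
by split=> //; do 6 eexists.
Qed.

(** After n rounds the ball of radius n is labelled, and a path without repeated vertices has fewer
    than n edges. *)
Lemma labelled_connect (o : 'I_n) lab : val o = 0 -> labelled n 0 0 lab ->
  forall x : 'I_n,
  (lab x != 0) = connect (fun x y : 'I_n => certified x y) o x.
Proof.
move=> o0 H x; have [H1 H2 _] := H _ (ltn_ord x); apply/idP/idP.
  move=> /H1[d]; elim: d x {H1 H2} => /= [|d IH] x.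
    by move=> x0; rewrite (_ : x = o) //; apply: val_inj; rewrite o0.
  case=> [/IH//|[y [yn /(IH (Ordinal yn)) oy cyx]]].
  by apply: connect_trans oy (connect1 _).
case/connectP => p /shortenP[p' pp' up' _] ->.
have {H1 H2} : size p' < n.
  by have := card_uniqP up'; rewrite -[n in _ < n]card_ord /= => <-; exact: max_card.
suff Hb d : size p' <= d -> ball d (last o p').
  move=> pn; have [_ H2 _] := H _ (ltn_ord (last o p')).
  by apply/H2/Hb/ltnW.
elim/last_ind: p' d pp' {up'} => [|p' y IH] d; first by move=> _ _; elim: d => //= d; left.
rewrite rcons_path last_rcons size_rcons => /andP[pp' cy].
case: d => // d pd; right; exists (last o p'); split=> //.
exact: IH.
Qed.

End Propagation.

(* The address of the entry (1, 1), which is 0 in the input: a counter that does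
   not destroy the matrix, to be used before [B] is known. *)
Definition scratch := Add num_vertices (Const 2).
Definition prelude :=
  Seq (Write (Const 1) (Const 1))
    (Seq (While (Defs.Sub num_vertices (Read scratch))
            (Seq (Write (Const 1) (Add (Read (Const 1)) num_vertices))
                 (Write scratch (Add (Read scratch) (Const 1)))))
         (Write scratch (Const 0))).
(** Variable 8 is doubled until it reaches n; variable 7, initially 0, counts the doublings and ends
    as [up_log 2 n]. *)
Definition log_loop :=
  Seq (set_var 8 (Const 1))
    (While (Defs.Sub num_vertices (fetch 8))
      (Seq (set_var 8 (Add (fetch 8) (fetch 8))) (incr 7))).
(** Cells 0 and 1 come last, in this order: the loop test needs n in cell 0, and every address of a
    label needs [B] in cell 1. *)
Definition copy_labels :=
  Seq (set_var 3 (Const 2))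
    (Seq (While (Defs.Sub num_vertices (fetch 3))
            (Seq (Write (fetch 3) (get_lab (fetch 3))) (incr 3)))
         (Seq (Write (Const 0) (get_lab (Const 0)))
              (Write (Const 1) (get_lab (Const 1))))).
Definition recovery p1 q1 p2 q2 :=
  Seq prelude (Seq log_loop (Seq (Write (lab_addr (Const 0)) (Const 1))
    (Seq (propagate p1 q1 p2 q2) copy_labels))).

Definition low_input n (e : rel 'I_n) : memory :=
  fun k => if k == 1 then n * n + 1 else input e k.

(** * The phases of the program on the input memory *)

Section Input.
Variables (n : nat) (e : rel 'I_n).

Lemma input_entry (x y : 'I_n) : input e (1 + n * x + y) = e x y.
Proof.
rewrite -addnA /= ; congr nat_of_bool.
apply/idP/idP => [/existsP[i /existsP[j /andP[/eqP xy]]]|exy]; last first.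
  by apply/existsP; exists x; apply/existsP; exists y; rewrite eqxx.
have := ltn_ord x; have := ltn_ord y; have := ltn_ord i; have := ltn_ord j.
move=> jn i_n yn xn.
have xi : x = i :> nat by nia.
have yj : y = j :> nat by nia.
by rewrite (val_inj xi) (val_inj yj).
Qed.

Lemma input_gt k : n * n < k -> input e k = 0.
Proof.
case: k => // k nk /=; case: existsP => // -[i /existsP[j /andP[/eqP ki _]]].
by have := ltn_ord i; have := ltn_ord j; nia.
Qed.

Hypothesis e_simple : simple_graph e.

(** For n > 1 the address n + 2 is the diagonal entry (1, 1), zero in a loopless graph; for smaller
    n it lies beyond the matrix. *)
Lemma input_scratch : input e (n + 2) = 0.
Proof.
rewrite addnC /=; case: existsP => // -[i /existsP[j /andP[/eqP ki eij]]].
have := ltn_ord i; have := ltn_ord j => jn i_n.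
suff ij : i = j by rewrite ij (proj2 e_simple) in eij.
have n2 : 1 < n by case: (n) (i) (j) jn i_n ki => [|[|?]] [a la] [c lc] //=; lia.
apply: val_inj => /=; case: (ltngtP i 1) => i1; nia.
Qed.

Let B := n * n + 1.
Let low := low_input e.
Let pre j : memory := fun k =>
  if k == n + 2 then j else if k == 1 then 1 + n * j else input e k.

(** Starting from 1 and adding n to cell 1 n times gives [B] without a product. Once the counter is
    reset, all cells above the matrix are 0, which reads as a [store] with zero variables and
    labels. *)
Lemma runs_prelude :
  runs prelude (input e) (fun m => m = store low B [::] (fun=> 0))
    (100 * n.+1).
Proof.
apply: (@runs_weaken _ _ _ _ (3 + ((20 + 30).+1 * n.+1 + 6).+1).+1)
  => [? H| |]; [exact: H | lia |].
apply: (runs_seq (Q := fun m => m = pre 0)).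
  apply: runs_write; apply/funext => k /=; rewrite /pre muln0 addn0.
  case: eqP => [->|_]; first by rewrite ifF //; lia.
  by case: eqP => // ->; exact: input_scratch.
have pre_scratch j : value (pre j) scratch = n + 2.
  by rewrite /= /pre /= ifF //; lia.
have n0 : (0 == n + 2) = false by lia.
have n1 : (1 == n + 2) = false by lia.
move=> _ ->; apply: (runs_seq (Q := fun m => m = pre n)); last first.
  move=> _ ->; apply: runs_write; rewrite pre_scratch; apply/funext => k /=.
  rewrite /pre /store /low /low_input /B.
  rewrite nth_nil if_same; case: eqP => [->|k2].
    by rewrite (_ : (n + 2 == 1) = false) ?input_scratch ?if_same //; lia.
  case: leqP => H; first by rewrite addnC.
  by rewrite ifF ?input_gt //; lia.
apply: (@runs_weaken _ _ (fun m => m = pre n) _ ((8 + 42).+1 * n.+1)) => //.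
apply: (@runs_while _ _ n (fun j m => m = pre j)) => //.
  move=> j _ jn ->; split.
    rewrite -[value _ _]/(value _ num_vertices - pre j (value _ scratch)) pre_scratch.
    by rewrite /pre /= eqxx ifF; lia.
  apply: (@runs_weaken _ _ (fun m => m = pre j.+1) _ (20+21).+1) => //.
  apply: (runs_seq (Q := fun m => m = fun k =>
       if k == n + 2 then j else if k == 1 then 1 + n * j.+1 else input e k)).
    apply: runs_weaken (runs_write _) => [m H||]; [exact: H | by [] |].
    apply/funext => k /=; rewrite /pre /= n0 n1 mulnS.
    by case: (k =P 1) => [->|_] //; rewrite n1; lia.
  move=> _ ->; apply: runs_weaken (runs_write _) => [m H||]; [exact: H | by [] |].
  apply/funext => k /=; rewrite /pre /= n0 eqxx.
  by case: eqP => // _; rewrite addn1.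
move=> _ ->; rewrite -[value _ _]/(value _ num_vertices - pre n (value _ scratch)) pre_scratch.
by rewrite /pre /= eqxx ifF; lia.
Qed.

Let B_gt : n * n < B. Proof. by rewrite /B; lia. Qed.
Let B_gt0 : 0 < B. Proof. by rewrite /B; lia. Qed.
Let low0 : low 0 = n. Proof. by []. Qed.
Let low1 : low 1 = B. Proof. by []. Qed.

Lemma runs_log :
  runs log_loop (store low B [::] (fun=> 0))
    (fun m => exists pw, m = store low B
      [:: 0; 0; 0; 0; 0; 0; 0; up_log 2 n; pw] (fun=> 0))
    (100 * n.+1).
Proof.
pose I j m := m = store low B [:: 0; 0; 0; 0; 0; 0; 0; j; 2 ^ j] (fun=> 0).
have up_n : up_log 2 n <= n.
  by apply: up_log_min => //; apply/ltnW/ltn_expl.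
apply: (@runs_weaken _ _ (I (up_log 2 n)) _ (6 + (8 + 50).+1 * (up_log 2 n).+1).+1).
- by move=> _ ->; eexists.
- lia.
apply: (runs_seq (Q := I 0)); first exact: runs_set_var.
move=> _ ->; apply: runs_while => //.
  move=> j _ jn ->; split.
    rewrite -[value _ _]/(value _ num_vertices - value _ (fetch 8)).
    rewrite (@value_num_vertices n B low low0) (@value_fetch n B low B_gt0 low0 low1) //=.
    rewrite -lt0n subn_gt0 ltnNge; apply/negP => /(up_log_min (isT : 1 < 2)).
    by rewrite leqNgt jn.
  apply: (@runs_weaken _ _ (I j.+1) _ (16 + 12).+1) => //.
  apply: (runs_seq (Q := fun m => m = store low B [:: 0; 0; 0; 0; 0; 0; 0; j; 2 ^ j.+1] (fun=> 0))).
    apply: runs_set_var => //.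
    rewrite -[value _ _]/(value _ (fetch 8) + value _ (fetch 8)).
    by rewrite (@value_fetch n B low B_gt0 low0 low1) //= addnn -mul2n expnS.
  by move=> _ ->; exact: runs_incr.
move=> _ ->; rewrite -[value _ _]/(value _ num_vertices - value _ (fetch 8)).
rewrite (@value_num_vertices n B low low0) (@value_fetch n B low B_gt0 low0 low1) //=.
by apply/eqP; rewrite subn_eq0 up_logP.
Qed.

Lemma runs_copy vars lab :
  runs copy_labels (store low B vars lab)
    (fun m => forall i, i < n -> m i = lab i) (100 * n.+1).
Proof.
(* The labels overwrite the low memory from cell 2 on; cells 0 and 1 are kept, so the lemmas on
   [store] apply to each [lw j]. *)
pose lw j : memory := fun k => if 1 < k < 2 + j then lab k else low k.
have lw0 j : lw j 0 = n by [].
have lw1 j : lw j 1 = B by [].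
pose I j m := m = store (lw j) B (set_nth 0 vars 3 (2 + j)) lab.
apply: (@runs_weaken _ _ (fun m => forall i, i < n -> m i = lab i) _
   (6 + ((8 + 40).+1 * (n - 2).+1 + (9 + 9).+1).+1).+1) => //; first lia.
apply: (runs_seq (Q := I 0)).
  apply: runs_set_var => //=; congr store; apply/funext => k.
  by rewrite /lw addn0 ifF //; lia.
move=> _ ->; apply: (runs_seq (Q := I (n - 2))).
  apply: runs_while => //.
    move=> j _ jn ->; split.
      rewrite -[value _ _]/(value _ num_vertices - value _ (fetch 3)).
      rewrite (@value_num_vertices n B (lw j)) // (@value_fetch n B (lw j)) //.
      by rewrite nth_set_nth /=; lia.
    apply: (@runs_weaken _ _ (I j.+1) _ (20 + 12).+1) => //.
    apply: (runs_seq (Q := fun m => m = store (lw j.+1) B (set_nth 0 vars 3 (2 + j)) lab)).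
      apply: runs_weaken (runs_write _) => [m H||]; [exact: H | by [] |].
      rewrite (@value_get_lab n B (lw j)) // (@value_fetch n B (lw j)) //.
      rewrite nth_set_nth /=; apply/funext => k /=; rewrite /store.
      case: eqP => [->|kj]; first by rewrite ifT ?/lw ?ifT //; rewrite /B; nia.
      case: ifP => // _; rewrite /lw; congr (if _ then _ else _); lia.
    move=> _ ->; apply: runs_incr => //.
    by rewrite nth_set_nth /= set_set_nth.
  move=> _ ->; rewrite -[value _ _]/(value _ num_vertices - value _ (fetch 3)).
  rewrite (@value_num_vertices n B (lw _)) // (@value_fetch n B (lw _)) //.
  by rewrite nth_set_nth /=; lia.
move=> _ ->; set vars' := set_nth _ _ _ _.
pose lw' : memory := fun k => if k == 0 then lab 0 else lw (n - 2) k.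
apply: (runs_seq (Q := fun m => m = store lw' B vars' lab)).
  apply: runs_weaken (runs_write _) => [m H||]; [exact: H | by [] |].
  rewrite (@value_get_lab n B (lw (n - 2))) //=.
  by apply/funext => k /=; rewrite /store /lw'; case: eqP => // ->.
move=> _ ->; apply: runs_weaken (runs_write _) => [m H||]; [exact: H | by [] |].
(* Cell 0 now holds [lab 0] instead of n; addressing only relies on cell 1. *)
move=> i i_n; rewrite (@value_get_lab (lab 0) B lw') //=.
case: eqP => [->//|i1]; rewrite /store ifT; last by rewrite /B; nia.
by rewrite /lw' /lw; case: eqP => [->//|i0]; rewrite ifT //; lia.
Qed.

Lemma runs_recovery p1 q1 p2 q2 :
  runs (recovery p1 q1 p2 q2) (input e) (fun m => exists lab : memory,
      labelled p1 q1 p2 q2 n low n 0 0 lab /\ forall i, i < n -> m i = lab i)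
    ((1000 + cost (test p1 q1 p2 q2)) * n.+1 ^ 4).
Proof.
set C := cost _.
apply: (@runs_weaken _ _ (fun m => exists lab : memory,
      labelled p1 q1 p2 q2 n low n 0 0 lab /\ forall i, i < n -> m i = lab i) _
  (100 * n.+1 + (100 * n.+1 + (10 + ((500 + C) * n.+1 ^ 4 + 100 * n.+1).+1).+1).+1).+1).
- by [].
- rewrite expnS; have := expn_gt0 n.+1 3; move: (n.+1 ^ 3) => N /= N0; nia.
apply: (runs_seq (Q := fun m => m = store low B [::] (fun=> 0))).
  exact: runs_prelude.
move=> _ ->; apply: runs_seq; first exact: runs_log.
move=> _ [pw ->].
apply: (runs_seq (Q := fun m => exists lab : memory, labelled p1 q1 p2 q2 n low 0 0 0 lab /\
  m = store low B [:: 0; 0; 0; 0; 0; 0; 0; up_log 2 n; pw] lab)).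
  apply: runs_weaken (runs_write _) => [m H||]; [exact: H | by [] |].
  rewrite (@value_lab_addr B low) // (@store_set_lab n B low) //.
  eexists; split; last by [].
  move=> x xn; split => [|->//|_ y _ _]; last lia.
  by rewrite /=; case: (x =P 0) => // -> _; exists 0.
move=> _ [lab [Hlab ->]].
apply: runs_seq.
  exact: (@runs_propagate p1 q1 p2 q2 n B low B_gt low0 low1 0 0 0 0 0 0 0 pw lab Hlab).
move=> _ [vars [l [Hl ->]]].
apply: runs_weaken (@runs_copy vars l) => // m Hm.
by exists l.
Qed.

End Input.

(* The graph that the program sees: [B] has overwritten the entry (0, 0). *)
Definition rooted n (e : rel 'I_n) : rel 'I_n :=
  fun x y => e x y || ((val x == 0) && (val y == 0)).

(** The thresholds on the number of common neighbours are the multiples p1 / q1 and p2 / q2 of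
    [up_log 2 n]. The loop at vertex 0 can only add an endpoint of the edge to the count. *)
Definition certificate p1 q1 p2 q2 n (e : rel 'I_n) : rel 'I_n := fun x y =>
  let c := #|[set w | rooted e x w && rooted e y w]%SET| in
  rooted e x y && ((p1 * up_log 2 n < q1 * c) || (q2 * c < p2 * up_log 2 n)).

Lemma adj_low_input n (e : rel 'I_n) (x y : 'I_n) :
  adj n (low_input e) x y = rooted e x y.
Proof.
rewrite /adj /low_input /rooted.
have [/andP[/eqP -> /eqP ->]|xy0] := boolP ((val x == 0) && (val y == 0)).
  by rewrite muln0 orbT /= addn1.
rewrite ifF ?input_entry ?orbF; first by case: (e x y).
have := ltn_ord x; move: xy0; rewrite /=.
move: (nat_of_ord x) (nat_of_ord y) => i j ij jn.
apply/eqP => ij1; have /eqP : n * i + j = 0 by lia.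
by rewrite addn_eq0 muln_eq0; move: ij; case: (i == 0); case: (j == 0); lia.
Qed.

Lemma common_low_input n (e : rel 'I_n) (x y : 'I_n) :
  common n (low_input e) x y n = #|[set w | rooted e x w && rooted e y w]%SET|.
Proof.
rewrite /common -val_enum_ord count_map cardE [in RHS]size_filter -enumT /=.
by apply: eq_count => w /=; rewrite inE !adj_low_input.
Qed.

Lemma recovery_polynomial p1 q1 p2 q2 :
  polynomial_time (recovery p1 q1 p2 q2).
Proof.
exists (1000 + cost (test p1 q1 p2 q2)), 4 => n e es.
have [m [t [pm _ tT]]] := runs_recovery es p1 q1 p2 q2.
by exists m, t.
Qed.

Lemma recovery_correct p1 q1 p2 q2 n (e : rel 'I_n) (o : 'I_n) :
  simple_graph e -> val o = 0 ->
  exists m t, exec (recovery p1 q1 p2 q2) (input e) m t /\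
    forall i : 'I_n, (m i != 0) = connect (certificate p1 q1 p2 q2 e) o i.
Proof.
move=> es o0.
have [m [t [pm [lab [Hl Hm]] _]]] := runs_recovery es p1 q1 p2 q2.
exists m, t; split=> // i; rewrite Hm // (labelled_connect o0 Hl).
by apply: eq_connect => x y; rewrite /certified common_low_input adj_low_input.
Qed.

(** * Connectivity of gap graphs on a line *)

Section Window.
Variables (T : finType) (P : pred T) (x : T -> nat) (R : rel T) (E : pred nat).
Variables (D l W : nat).
Hypothesis R_refl : reflexive R.
Hypothesis R_sym : symmetric R.
Hypothesis R_trans : transitive R.
Hypothesis R_edge : forall u v, P u -> P v -> x u <= x v -> x v < W ->
  E (x v - x u) -> R u v.
Hypothesis E_le : forall d, E d -> d <= D.
Hypothesis E_succ : exists d, E d /\ E d.+1.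
Hypothesis hit : forall s : seq nat, uniq s -> all (fun y => y < W) s ->
  l <= size s -> exists u, P u /\ x u \in s.
Hypothesis E_large : l <= count E (iota 1 D) \/
  exists s, [/\ forall d, s <= d <= D -> E d, l <= 2 * (D.+1 - s) & l <= D].

Let occupied y := exists u, P u /\ x u = y.
Let len := 2 * D.+2.
Let lenE : len = 2 * D.+2. Proof. by []. Qed.
Let stretch p := forall y, p <= y < p + len -> occupied y.

(** Otherwise each of [l] consecutive blocks of length [len] has an empty position, and these [l]
    positions contradict [hit]. *)
Lemma exists_stretch q : q + l * len <= W ->
  exists p, [/\ q <= p, p + len <= q + l * len & stretch p].
Proof.
move=> qW; apply: contrapT => no.
have /choice[f Hf] i : exists fi, i < l ->
    q + i * len <= fi < q + i.+1 * len /\ ~ occupied fi.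
  have [il|] := ltnP i l; last by exists 0.
  apply: contrapT => no'; apply: no; exists (q + i * len); split.
  - by lia.
  - by nia.
  - move=> y yi; apply: contrapT => ny; apply: no'; exists y => _; split => //.
    by rewrite mulSn; lia.
have mono i j : j < l -> i < j -> f i < f j.
  move=> jl ij; have [|/andP[_ fi] _] := Hf i; first by lia.
  have [//|/andP[fj _] _] := Hf j; nia.
have [] := hit (s := [seq f i | i <- iota 0 l]).
- rewrite map_inj_in_uniq ?iota_uniq // => i j.
  rewrite !mem_iota !add0n /= => il jl fij.
  by case: (ltngtP i j) => // ij; [have := mono _ _ jl ij|have := mono _ _ il ij]; lia.
- apply/allP => _ /mapP[i + ->]; rewrite mem_iota add0n /= => il.
  by have [//|/andP[_ fi] _] := Hf i; nia.
- by rewrite size_map size_iota.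
- move=> u [Pu /mapP[i + xu]]; rewrite mem_iota add0n /= => il.
  by have [//|_ no'] := Hf i; apply: no'; exists u.
Qed.

(** The two points have a common partner [w], whose distance to each is one of the consecutive
    certified distances [d] and [d.+1]. The length of the stretch leaves room for [w] on the left or
    on the right. *)
Lemma stretch_step p u v : stretch p -> p + len <= W -> P u -> P v ->
  p <= x u -> x v < p + len -> x u <= x v <= (x u).+1 -> R u v.
Proof.
move=> sp pW Pu Pv pu vp uv; have [d [Ed Ed1]] := E_succ.
have dD := E_le Ed1.
have E01 e : d <= e <= d.+1 -> E e.
  by move=> de; have [->|->] : e = d \/ e = d.+1 by lia.
have [up|up] := leqP (p + len) ((x u) + d.+1).
  have [|w [Pw xw]] := sp (x u - d); first by lia.
  have wu : R w u by apply: R_edge => //; [lia|lia|apply: E01; lia].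
  have wv : R w v by apply: R_edge => //; [lia|lia|apply: E01; lia].
  by rewrite R_sym in wu; apply: R_trans wv.
have [|w [Pw xw]] := sp (x u + d.+1); first by lia.
have wu : R u w by apply: R_edge => //; [lia|lia|apply: E01; lia].
have [vw|vw] := leqP (x v) (x w).
  have wv : R v w by apply: R_edge => //; [lia|apply: E01; lia].
  by rewrite R_sym in wv; apply: R_trans wu _.
lia.
Qed.

Lemma stretch_connected p u v : stretch p -> p + len <= W -> P u -> P v ->
  p <= x u < p + len -> p <= x v < p + len -> R u v.
Proof.
move=> sp pW Pu Pv; wlog uv : u v Pu Pv / x u <= x v.
  move=> H; have [uv|/ltnW uv] := leqP (x u) (x v); first exact: H.
  by move=> up vp; rewrite R_sym; exact: H.
move En : (x v - x u) => n; elim: n v Pv uv En => [|n IH] v Pv uv En up vp.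
  by apply: (stretch_step sp pW) => //; lia.
have [|w [Pw xw]] := sp (x v).-1; first by lia.
apply: (@R_trans w); first by apply: IH => //; lia.
by apply: (stretch_step sp pW) => //; lia.
Qed.

(** * Points between two occupied stretches *)

Section Between.
Variables p1 p2 : nat.
Hypotheses (sp1 : stretch p1) (sp2 : stretch p2).
Hypotheses (p12 : p1 + len <= p2) (p2W : p2 + len <= W).

Let inner u := P u && (p1 <= x u < p2 + len).

Let R_dist u v : inner u -> inner v -> (x u <= x v -> E (x v - x u)) ->
  (x v <= x u -> E (x u - x v)) -> R u v.
Proof.
move=> /andP[Pu /andP[u1 u2]] /andP[Pv /andP[v1 v2]] uv vu.
have [h|/ltnW h] := leqP (x u) (x v); first by apply: R_edge => //; [lia|exact: uv].
by rewrite R_sym; apply: R_edge => //; [lia|exact: vu].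
Qed.

Let right_free (C : pred T) r := [/\ C r, inner r, x r < p2 &
  forall d u, P u -> 0 < d -> E d -> x u != x r + d].
Let left_free (C : pred T) r := [/\ C r, inner r, p1 + len <= x r &
  forall d u, P u -> 0 < d -> E d -> x u + d != x r].

(** Take the rightmost inner point of [C]. A point at certified distance to its right is still
    inner, since [D] is less than [len], hence it would belong to [C]. *)
Lemma exists_right_free (C : pred T) u0 : C u0 -> inner u0 ->
  (forall u v, C u -> inner u -> inner v -> R u v -> C v) ->
  (forall u, C u -> inner u -> x u < p2) ->
  exists r, right_free C r /\ forall u, C u -> inner u -> x u <= x r.
Proof.
move=> Cu0 iu0 Cclosed Cp2.
case: (@arg_maxnP _ u0 (fun u => C u && inner u) x); first by rewrite Cu0.
move=> r /andP[Cr ir] rmax; exists r; split; last first.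
  by move=> u Cu iu; apply: rmax; rewrite Cu.
split=> //; first exact: Cp2.
move=> d u Pu d0 Ed; apply/eqP => xu; have dD := E_le Ed.
have rp2 := Cp2 _ Cr ir; have ir' := ir; move: ir' => /andP[_ /andP[r1 r2]].
have iu : inner u by rewrite /inner Pu xu /len; lia.
have Cu : C u.
  apply: (Cclosed r) => //; apply: R_dist => // h; last lia.
  by rewrite xu addKn.
by have := rmax u; rewrite Cu iu => /(_ isT); lia.
Qed.

Lemma exists_left_free (C : pred T) u0 : C u0 -> inner u0 ->
  (forall u v, C u -> inner u -> inner v -> R u v -> C v) ->
  (forall u, C u -> inner u -> p1 + len <= x u) ->
  exists r, left_free C r /\ forall u, C u -> inner u -> x r <= x u.
Proof.
move=> Cu0 iu0 Cclosed Cp1.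
case: (@arg_minnP _ u0 (fun u => C u && inner u) x); first by rewrite Cu0.
move=> r /andP[Cr ir] rmin; exists r; split; last first.
  by move=> u Cu iu; apply: rmin; rewrite Cu.
split=> //; first exact: Cp1.
move=> d u Pu d0 Ed; apply/eqP => xu; have dD := E_le Ed.
have rp1 := Cp1 _ Cr ir; have ir' := ir; move: ir' => /andP[_ /andP[r1 r2]].
have iu : inner u by rewrite /inner Pu; lia.
have Cu : C u.
  apply: (Cclosed r) => //; apply: R_dist => // h; first lia.
  by rewrite -xu addKn.
by have := rmin u; rewrite Cu iu => /(_ isT); lia.
Qed.

Lemma right_free_counts (C : pred T) r :
  right_free C r -> l <= count E (iota 1 D) -> False.
Proof.
move=> [_ _ rp2 rfree] El.
have [] := hit (s := [seq x r + d | d <- iota 1 D & E d]).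
- rewrite map_inj_uniq ?filter_uniq ?iota_uniq //; exact: addnI.
- apply/allP => _ /mapP[d + ->]; rewrite mem_filter mem_iota; lia.
- by rewrite size_map size_filter.
- move=> u [Pu /mapP[d + xu]]; rewrite mem_filter mem_iota => /andP[Ed d1].
  by have := rfree d u Pu _ Ed; rewrite xu eqxx; lia.
Qed.

(** The positions from [x r + s] to [x r + D] and from [x r' - D] to [x r' - s] are empty. The bound
    on [x r'] makes the two ranges disjoint, so together they have at least [l] positions. *)
Lemma two_sided_free (C C' : pred T) r r' s : right_free C r -> left_free C' r' ->
  (forall d, s <= d <= D -> E d) -> l <= 2 * (D.+1 - s) ->
  0 < s -> x r' < x r + s -> False.
Proof.
move=> [_ /andP[_ r1] rp2 rfree] [_ /andP[_ r1'] rp1 rfree'] Es ls s0 rr'.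
have [] := hit (s := iota (x r + s) (D.+1 - s) ++ iota (x r' - D) (D.+1 - s)).
- rewrite cat_uniq !iota_uniq andbT /=; apply/hasPn => y.
  rewrite !mem_iota; lia.
- by apply/allP => y; rewrite mem_cat !mem_iota; lia.
- by rewrite size_cat !size_iota; lia.
- move=> u [Pu]; rewrite mem_cat !mem_iota => /orP[] us.
    have := rfree (x u - x r) u Pu _ (Es _ _); rewrite subnKC ?eqxx; lia.
  have := rfree' (x r' - x u) u Pu _ (Es _ _).
  rewrite subnKC ?eqxx; lia.
Qed.

(** If s = 0, all distances from 1 to [D] are certified and the count is [D], at least [l]; hence s
    may be taken positive. *)
Lemma E_small_start : ~ l <= count E (iota 1 D) ->
  exists s, [/\ 0 < s, forall d, s <= d <= D -> E d, l <= 2 * (D.+1 - s) & l <= D].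
Proof.
move=> notA; case: E_large => // -[s [Es ls lD]].
have [s0|s0] := posnP s; last by exists s.
case: notA; subst s.
rewrite (eq_in_count (a2 := predT)) ?count_predT ?size_iota // => d.
by rewrite mem_iota => dD; rewrite Es //; lia.
Qed.

Lemma between_connected u v : inner u -> inner v -> R u v.
Proof.
have [s1 [Ps1 xs1]] : occupied p1 by apply: sp1; lia.
have [s2 [Ps2 xs2]] : occupied p2 by apply: sp2; lia.
have is1 : inner s1 by rewrite /inner Ps1; lia.
have is2 : inner s2 by rewrite /inner Ps2; lia.
have S1 w : inner w -> x w < p1 + len -> R s1 w.
  by move=> /andP[Pw w1] w2; apply: (stretch_connected sp1) => //; lia.
have S2 w : inner w -> p2 <= x w -> R s2 w.
  by move=> /andP[Pw w1] w2; apply: (stretch_connected sp2) => //; lia.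
have Rclosed a (w w' : T) : R a w -> inner w -> inner w' -> R w w' -> R a w'.
  by move=> aw _ _; apply: R_trans.
(* First the two stretches are joined, by comparing the rightmost point r of the component of [s1]
   with the leftmost point r' outside this component. *)
have s12 : R s1 s2.
  apply: contrapT => s12.
  have C1p2 w : R s1 w -> inner w -> x w < p2.
    move=> s1w iw; rewrite ltnNge; apply/negP => /(S2 w iw) s2w; apply: s12.
    by apply: R_trans s1w _; rewrite R_sym.
  have [r [rfree rmax]] := exists_right_free (S1 s1 is1 ltac:(lia))
    is1 (@Rclosed s1) C1p2.
  have [/(right_free_counts rfree)//|/E_small_start[s [s0 Es ls lD]]] :=
    pselect (l <= count E (iota 1 D)).
  have C2 w w' : ~~ R s1 w -> inner w -> inner w' -> R w w' -> ~~ R s1 w'.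
    move=> nw _ _ ww'; apply: contra nw => s1w'; apply: R_trans s1w' _.
    by rewrite R_sym.
  have C2p1 w : ~~ R s1 w -> inner w -> p1 + len <= x w.
    by move=> nw iw; rewrite leqNgt; apply: contra nw; exact: S1.
  have [r' [rfree' rmin]] := @exists_left_free (fun w => ~~ R s1 w) s2
    (introN idP s12) is2 C2 C2p1.
  have [rs|rs] := ltnP (x r') (x r + s); first exact: two_sided_free rfree rfree' Es ls s0 rs.
  have [Cr ir rp2 _] := rfree; have [Cr' ir' rp1 _] := rfree'.
  have [rD|rD] := leqP (x r') (x r + D).
    move/negP: Cr'; apply; apply: R_trans Cr _; apply: R_dist => // h; last lia.
    by apply: Es; lia.
  (* Now r' is more than [D] beyond r. The [D] positions after r cannot all be empty, but a point
     there would lie beyond r inside the component, or before r' outside it. *)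
  have [] := hit (s := iota (x r).+1 D); rewrite ?iota_uniq ?size_iota //.
    by apply/allP => y; rewrite mem_iota; case/andP: ir'; lia.
  move=> w [Pw]; rewrite mem_iota => wr.
  have iw : inner w by rewrite /inner Pw; case/andP: ir ir' => _ ? /andP[_]; lia.
  have [s1w|ns1w] := boolP (R s1 w).
    by move: (rmax w s1w iw) wr; clear; lia.
  by move: (rmin w ns1w iw) wr rD; clear; lia.
suff H w : inner w -> R s1 w.
  by move=> iu iv; apply: R_trans (H _ iv); rewrite R_sym H.
(* A component that meets neither stretch has a rightmost point r and a leftmost point r' with
   [x r' <= x r], and both sides of it are empty. *)
move=> iw; apply: contrapT => s1w.
have Cp2 w' : R w w' -> inner w' -> x w' < p2.
  move=> ww' iw'; rewrite ltnNge; apply/negP => /(S2 w' iw') s2w'.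
  apply: s1w; apply: R_trans s12 _; apply: R_trans s2w' _.
  by rewrite R_sym.
have Cp1 w' : R w w' -> inner w' -> p1 + len <= x w'.
  move=> ww' iw'; rewrite leqNgt; apply/negP => /(S1 w' iw') s1w'.
  by apply: s1w; apply: R_trans s1w' _; rewrite R_sym.
have [r [rfree rmax]] := exists_right_free (R_refl w) iw (@Rclosed w) Cp2.
have [r' [rfree' rmin]] := exists_left_free (R_refl w) iw (@Rclosed w) Cp1.
have [/(right_free_counts rfree)//|/E_small_start[s [s0 Es ls lD]]] :=
  pselect (l <= count E (iota 1 D)).
apply: (two_sided_free rfree rfree' Es ls s0).
by have [_ _ _ _] := rfree; have := rmax w (R_refl w) iw; have := rmin w (R_refl w) iw; lia.
Qed.

End Between.
(** A stretch is found in the room left on either side of the points, and the points lie between the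
    two. *)
Lemma window_connected q q' u v : q + l * len <= q' -> q' + l * len <= W ->
  P u -> P v -> q + l * len <= x u < q' -> q + l * len <= x v < q' -> R u v.
Proof.
move=> qq' qW Pu Pv uq vq.
have [|p1 [qp1 p1q sp1]] := @exists_stretch q; first lia.
have [|p2 [qp2 p2q sp2]] := @exists_stretch q'; first lia.
apply: (between_connected sp1 sp2); [lia|lia| |].
  by rewrite Pu; lia.
by rewrite Pv; lia.
Qed.

End Window.

(** * Certificates from cell counts *)

(** The clockwise distance from cell i to cell k on a circle of K cells: reading offsets from a base
    i turns an arc of the circle into an interval. *)
Definition offset K i k := if i <= k then k - i else k + K - i.
Definition cell_dist K k l := minn (offset K k l) (offset K l k).

Lemma offset_cases K i k : (i <= k /\ offset K i k = k - i) \/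
  (k < i /\ offset K i k = k + K - i).
Proof. by rewrite /offset; case: leqP => h; [left|right]. Qed.

Section Offsets.
Variables K W : nat.
Hypothesis WK : 2 * W <= K.

Lemma exists_base Q k : Q < K -> k < K -> exists2 i, i < K & offset K i k = Q.
Proof.
move=> QK kK; have [Qk|kQ] := leqP Q k.
  by exists (k - Q); [|have := offset_cases K (k - Q) k]; lia.
by exists (k + K - Q); [|have := offset_cases K (k + K - Q) k]; lia.
Qed.

(** Since 2 W <= K, the arc inside the window is the shorter of the two arcs between k and l. *)
Lemma cell_dist_offset i k l : i < K -> k < K -> l < K ->
  offset K i k <= offset K i l < W ->
  cell_dist K k l = offset K i l - offset K i k.
Proof.
move=> iK kK lK; rewrite /cell_dist.
have := offset_cases K i k; have := offset_cases K i l.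
have := offset_cases K k l; have := offset_cases K l k; lia.
Qed.

Lemma cell_dist_le i k l r : i < K -> k < K -> l < K ->
  r <= offset K i k -> offset K i k + r < W ->
  (cell_dist K k l <= r) =
  (offset K i l \in iota (offset K i k - r) (2 * r).+1).
Proof.
move=> iK kK lK; rewrite mem_iota /cell_dist.
have := offset_cases K i k; have := offset_cases K i l.
have := offset_cases K k l; have := offset_cases K l k; lia.
Qed.

Lemma offset_shift i j k d : i < K -> j < K -> k < K ->
  offset K j i = d -> d + offset K i k < K -> offset K j k = d + offset K i k.
Proof.
move=> iK jK kK; have := offset_cases K i k; have := offset_cases K j k.
have := offset_cases K j i; lia.
Qed.

Lemma cell_distC k l : cell_dist K k l = cell_dist K l k.
Proof. exact: minnC. Qed.

End Offsets.

Lemma rootedP n (e : rel 'I_n) x y : x != y -> rooted e x y = e x y.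
Proof.
rewrite /rooted => xy; case: (e x y) => //=; apply/negbTE; apply: contra xy.
by move=> /andP[/eqP x0 /eqP y0]; apply/eqP/val_inj; rewrite /= x0.
Qed.

Lemma certificate_sym p1 q1 p2 q2 n (e : rel 'I_n) : symmetric e ->
  symmetric (certificate p1 q1 p2 q2 e).
Proof.
move=> es x y; rewrite /certificate.
have -> : rooted e x y = rooted e y x by rewrite /rooted es andbC.
suff -> : [set w | rooted e x w && rooted e y w]%SET =
  [set w | rooted e y w && rooted e x w]%SET by [].
by apply/setP => w; rewrite !inE andbC.
Qed.

Definition window K W i (r1 r0 : seq nat) := [&& i < K, uniq r1, uniq r0,
  all (fun y => y < W) r1 & all (fun y => y < W) r0].

(** Each part has its own list of offsets because the common neighbours of an edge (u, v) between
    the parts lie around v in the part of u, and around u in the part of v. *)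
Definition hits n (V1 : {set 'I_n}) K (c : 'I_n -> nat) i (s1 s0 : seq nat) :=
  #|[set v | offset K i (c v) \in (if v \in V1 then s1 else s0)]%SET|.

Section Recovery.
Variables (n : nat) (V1 : {set 'I_n}) (e : rel 'I_n) (K W : nat).
Variables (c : 'I_n -> nat) (p1 q1 p2 q2 alpha beta s1 s2 l : nat).
Hypothesis e_sym : symmetric e.
Hypothesis c_lt : forall v, c v < K.
Hypothesis WK : 2 * W <= K.
Let L := up_log 2 n.
Let D := alpha - 3.
Let E d := (d < s1) || (s2 <= d <= D).
Local Notation dist u v := (cell_dist K (c u) (c v)).
Local Notation same u v := ((u \in V1) == (v \in V1)).
Local Notation hits := (hits V1 K c).

Hypothesis near_same : forall u v, u != v -> same u v ->
  dist u v + 3 <= alpha -> e u v.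
Hypothesis far_same : forall u v, same u v -> e u v -> dist u v <= alpha.+1.
Hypothesis near_cross : forall u v, ~~ same u v -> dist u v + 3 <= beta -> e u v.
Hypothesis far_cross : forall u v, ~~ same u v -> e u v -> dist u v <= beta.+1.

Hypothesis W_ge1 : 4 * alpha + 10 <= W.
Hypothesis W_ge2 : 2 * (l * (2 * D.+2)) + l.+1 <= W.
Hypothesis alpha_ge : 2 * beta <= alpha.
Hypothesis beta_ge : 8 <= beta.
Hypothesis s1_le : s1 + 2 <= alpha.
Hypothesis s2_gt : 2 * beta + 2 < s2.
Hypothesis l_gt0 : 0 < l.

Local Notation window := (window K W).
Hypothesis few_cross : forall i r1 r0, window i r1 r0 ->
  size r1 + size r0 <= 4 * beta + 6 -> q1 * hits i r1 r0 <= p1 * L.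
Hypothesis many_cross : forall i r1 r0, window i r1 r0 ->
  4 * beta - 26 <= size r1 + size r0 -> p2 * L <= q2 * (hits i r1 r0 - 2).
Hypothesis many_short : forall i r1 r0, 0 < s1 -> window i r1 r0 ->
  2 * alpha - 5 - s1 <= size r1 + size r0 -> p1 * L < q1 * (hits i r1 r0 - 2).
Hypothesis few_long : forall i r1 r0, s2 <= D -> window i r1 r0 ->
  size r1 + size r0 <= 2 * alpha + 3 - s2 -> q2 * hits i r1 r0 < p2 * L.
Hypothesis occupied : forall i r1 r0, window i r1 r0 ->
  l <= size r1 + size r0 -> 0 < hits i r1 r0.
Hypothesis E_succ : exists d, E d /\ E d.+1.
Hypothesis E_large : l <= count E (iota 1 D) \/
  exists s, [/\ forall d, s <= d <= D -> E d, l <= 2 * (D.+1 - s) & l <= D].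

Let cert := certificate p1 q1 p2 q2 e.
Let common u v := [set w | rooted e u w && rooted e v w]%SET.

Lemma common_le_hits u v i r1 r0 :
  (forall w, rooted e u w -> rooted e v w ->
     offset K i (c w) \in (if w \in V1 then r1 else r0)) ->
  #|common u v| <= hits i r1 r0.
Proof.
move=> H; apply: subset_leq_card; apply/fintype.subsetP => w.
by rewrite !inE => /andP[uw vw]; exact: H.
Qed.

(** The cells may contain u and v themselves, whence the loss of 2. *)
Lemma hits_le_common u v i r1 r0 :
  (forall w, w != u -> w != v ->
     offset K i (c w) \in (if w \in V1 then r1 else r0) -> e u w && e v w) ->
  hits i r1 r0 - 2 <= #|common u v|.
Proof.
move=> H; rewrite leq_subLR.
have : hits i r1 r0 <= #|([set u; v] :|: common u v)%SET|.
  apply: subset_leq_card; apply/fintype.subsetP => w; rewrite !inE => wr.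
  have [//|wu] := eqVneq w u; have [//|wv] := eqVneq w v.
  have /andP[uw vw] := H w wu wv wr.
  by rewrite !rootedP ?uw // eq_sym.
move=> /leq_trans; apply; apply: leq_trans (leq_card_setU _ _) _.
by rewrite leq_add2r cards2; case: (_ != _).
Qed.

(** A common neighbour in the part of u is joined to v across the parts, hence lies within [beta.+1]
    cells of v; symmetrically for the part of v. Conversely, as [2 * beta <= alpha], a vertex
    slightly closer than [beta] to one endpoint in this way is adjacent to the other too. So the
    count concerns about 4 beta cells whatever the length of the edge. *)
Lemma cert_cross u v : u \in V1 -> v \notin V1 -> ~~ cert u v.
Proof.
move=> u1 v1; have uv : ~~ same u v by rewrite u1 (negbTE v1).
have uv' : u != v by apply: contra uv => /eqP ->.
rewrite /cert /certificate rootedP // -/(common u v) -/L.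
have [/= euv|//] := boolP (e u v).
(* With u at offset [2 * alpha + 4], all the cells in play lie after the base and inside the
   window. *)
have Q_lt : 2 * alpha + 4 < K by lia.
have [i iK iu] := exists_base WK Q_lt (c_lt u).
have := far_cross uv euv.
rewrite (@cell_dist_le K W WK i) ?iu ?mem_iota //; [|lia|lia] => iv.
have offv r w : r <= beta.+1 -> (dist v w <= r) =
    (offset K i (c w) \in iota (offset K i (c v) - r) (2 * r).+1).
  by move=> rb; rewrite (@cell_dist_le K W WK i) //; lia.
have offu r w : r <= beta.+1 -> (dist u w <= r) =
    (offset K i (c w) \in iota (offset K i (c u) - r) (2 * r).+1).
  by move=> rb; rewrite (@cell_dist_le K W WK i) ?iu //; lia.
have win r : r <= beta.+1 ->
    window i (iota (offset K i (c v) - r) (2 * r).+1)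
             (iota (offset K i (c u) - r) (2 * r).+1).
  move=> rb; apply/and5P; split; rewrite ?iota_uniq //;
    by apply/allP => y; rewrite mem_iota ?iu; lia.
rewrite negb_or -!leqNgt; apply/andP; split.
  apply: leq_trans (few_cross (win _ (leqnn _)) _); last by rewrite !size_iota; lia.
  rewrite leq_mul2l; apply/orP; right; apply: common_le_hits => w uw vw.
  have [w1|w1] := boolP (w \in V1).
    have vw1 : ~~ same v w by rewrite w1 (negbTE v1).
    have vnw : v != w by apply: contra vw1 => /eqP ->.
    by rewrite -offv //; apply: far_cross => //; rewrite rootedP in vw.
  have uw1 : ~~ same u w by rewrite u1 (negbTE w1).
  have unw : u != w by apply: contra uw1 => /eqP ->.
  by rewrite -offu //; apply: far_cross => //; rewrite rootedP in uw.
(* Radius [beta - 7] respects the margin 3 of [near_cross] and puts w within 2 beta - 6 cells of the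
   other endpoint, so that [near_same] applies as well. *)
have rb : beta - 7 <= beta.+1 by lia.
apply: leq_trans (many_cross (win _ rb) _) _; first by rewrite !size_iota; lia.
rewrite leq_mul2l; apply/orP; right; apply: hits_le_common => w wu wv.
have [w1|w1] := boolP (w \in V1) => wr.
  have vw1 : ~~ same v w by rewrite w1 (negbTE v1).
  rewrite [e v w]near_cross // ?andbT; last first.
    by have := offv _ w rb; rewrite wr; lia.
  apply: near_same; rewrite 1?eq_sym ?u1 ?w1 //.
  have := offu beta.+1; move: wr; rewrite mem_iota => wr.
  have -> : dist u w + 3 <= alpha = (dist u w <= alpha - 3) by lia.
  rewrite (@cell_dist_le K W WK i) ?iu ?mem_iota //; lia.
have uw1 : ~~ same u w by rewrite u1 (negbTE w1).
rewrite near_cross //=; last by have := offu _ w rb; rewrite wr; lia.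
apply: near_same; rewrite 1?eq_sym ?(negbTE v1) ?(negbTE w1) //.
move: wr; rewrite mem_iota => wr.
have -> : dist v w + 3 <= alpha = (dist v w <= alpha - 3) by lia.
rewrite (@cell_dist_le K W WK i) ?mem_iota //; lia.
Qed.

Let side b (r : seq nat) : seq nat * seq nat :=
  if b then (r, [::]) else ([::], r).

(** Same-part common neighbours lie in the intersection of two arcs, whose size decreases with the
    distance: short edges have too many of them for an edge between the parts, long ones too few. *)
Lemma cert_same u v : u != v -> same u v -> E (dist u v) -> cert u v.
Proof.
move=> uv suv Euv.
rewrite /cert /certificate rootedP // -/(common u v) -/L.
have dD : dist u v + 3 <= alpha by move: Euv; rewrite /E /D; lia.
rewrite near_same //=.
have Q_lt : 2 * alpha + 4 < K by lia.
have [i iK iu] := exists_base WK Q_lt (c_lt u).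
have : dist u v <= alpha by lia.
rewrite (@cell_dist_le K W WK i) ?iu ?mem_iota //; [|lia|lia] => iv.
pose o := offset K i (c v).
pose d := (maxn (2 * alpha + 4) o) - (minn (2 * alpha + 4) o).
have duv : dist u v = d.
  rewrite /d /o; have [h|/ltnW h] := leqP (2 * alpha + 4) (offset K i (c v)).
    rewrite (@cell_dist_offset K W WK i) // iu; lia.
  rewrite cell_distC (@cell_dist_offset K W WK i) // iu; lia.
(* The intersection of the arcs of radius s around u and v, on the side of the part of u. *)
pose r s := side (u \in V1) (iota (maxn (2 * alpha + 4) o - s) ((2 * s).+1 - d)).
have rw s w : s <= alpha.+1 ->
    (offset K i (c w) \in (if w \in V1 then (r s).1 else (r s).2)) =
    [&& same u w, dist u w <= s & dist v w <= s].
  move=> sa; rewrite !(@cell_dist_le K W WK i) ?iu //; try lia.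
  rewrite !mem_iota /r /side /d /o; case: (u \in V1); case: (w \in V1) => //=;
    rewrite mem_iota; lia.
have win s : s <= alpha.+1 -> window i (r s).1 (r s).2.
  move=> sa; rewrite /window iK /r /side; case: (u \in V1) => /=;
  rewrite ?iota_uniq ?andbT; by apply/allP => y; rewrite mem_iota; lia.
have szr s : size (r s).1 + size (r s).2 = (2 * s).+1 - d.
  by rewrite /r /side; case: ifP => _; rewrite /= size_iota; lia.
have DA : D <= alpha.+1 by rewrite /D; lia.
move: Euv; rewrite duv => /orP[ds|/andP[sd sdD]]; apply/orP; [left|right].
  apply: leq_trans (many_short _ (win _ DA) _) _; first lia.
    by rewrite szr /D; lia.
  rewrite leq_mul2l; apply/orP; right; apply: hits_le_common => w wu wv.
  rewrite rw // => /and3P[sw du dv].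
  rewrite !near_same //; rewrite 1?eq_sym //; move: du dv; rewrite /D; try lia.
apply: leq_ltn_trans (few_long _ (win alpha.+1 (leqnn _)) _); first last.
- by rewrite szr; lia.
- lia.
rewrite leq_mul2l; apply/orP; right; apply: common_le_hits => w uw vw.
rewrite rw //.
have [sw|sw] := boolP (same u w).
  have near a : same a w -> rooted e a w -> dist a w <= alpha.+1.
    move=> aw raw; have [<-|anw] := eqVneq a w.
      by rewrite /cell_dist /offset leqnn minnn subnn.
    by apply: far_same => //; rewrite rootedP in raw.
  by rewrite !near //; rewrite -(eqP suv).
(* A common neighbour in the other part is within [beta.+1] cells of both endpoints, whose distance
   would then be at most [2 * beta + 2], less than [s2]. *)
exfalso.
have vnw : ~~ same v w by rewrite -(eqP suv).
have := far_cross sw; rewrite rootedP in uw; last by apply: contra sw => /eqP ->.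
have := far_cross vnw; rewrite rootedP in vw; last by apply: contra vnw => /eqP ->.
move=> /(_ vw) + /(_ uw).
by rewrite !(@cell_dist_le K W WK i) ?iu ?mem_iota //; move: sd; rewrite /d /o; lia.
Qed.

Lemma hit_side b i r : i < K -> uniq r -> all (fun y => y < W) r -> l <= size r ->
  exists u, (u \in V1) == b /\ offset K i (c u) \in r.
Proof.
move=> iK ur rW lr.
have : 0 < hits i (side b r).1 (side b r).2.
  apply: occupied; last by rewrite /side; case: b; rewrite /= ?addn0 ?add0n.
  by rewrite /window iK /side; case: b => /=; rewrite ur rW.
rewrite card_gt0 => /set0Pn[u]; rewrite inE /side => ru.
by exists u; move: ru; case: b; case: (u \in V1).
Qed.

Let cert_sym : symmetric cert. Proof. exact: certificate_sym. Qed.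

(** The base is moved back by [l * (2 * D.+2)] cells, the room that [window_connected] needs on the
    left. *)
Lemma window_cert i u v : i < K -> same u v ->
  offset K i (c u) <= l -> offset K i (c v) <= l -> connect cert u v.
Proof.
move=> iK suv iu iv.
have lK : l * (2 * D.+2) < K by nia.
have [j jK ji] := exists_base WK lK iK.
have shift w : offset K i (c w) <= l ->
    offset K j (c w) = l * (2 * D.+2) + offset K i (c w).
  by move=> wl; apply: (offset_shift WK) => //; lia.
apply: (@window_connected _ (fun w => same u w) (fun w => offset K j (c w))
  (connect cert) E D l W _ _ _ _ _ _ _ _ 0 (l * (2 * D.+2) + l.+1)) => //.
- exact: sym_connect_sym.
- exact: connect_trans.
- move=> a b sa sb ab bW Eab; have [->|anb] := eqVneq a b; first exact: connect0.
  apply/connect1/cert_same => //; first by rewrite -(eqP sa).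
  by rewrite (@cell_dist_offset K W WK j) // ab.
- by move=> d; rewrite /E /D; lia.
- move=> s us sW ls; have [w [ws ow]] := @hit_side (u \in V1) j s jK us sW ls.
  by exists w; rewrite eq_sym.
- lia.
- lia.
- by rewrite shift //; lia.
- by rewrite shift //; lia.
Qed.

(** By [cert_cross] no certified edge leaves a part. Conversely, a vertex is connected to one of its
    part lying in the [l] preceding cells; strong induction on the cell index leads back to a fixed
    [u0] in the first [l] cells. *)
Lemma certificate_components u v : connect cert u v = same u v.
Proof.
have cert_same_part a b : cert a b -> same a b.
  move=> ab; case: (boolP (a \in V1)) (boolP (b \in V1)) => a1 [] b1 //.
    by have := cert_cross a1 b1; rewrite ab.
  by have := cert_cross b1 a1; rewrite cert_sym ab.
apply/idP/idP.
  case/connectP => p; elim: p u => [|a p IH] u /=; first by move=> _ ->.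
  by move=> /andP[/cert_same_part/eqP -> ap]; exact: IH.
suff [u0 H] : exists u0, forall w, same u w -> connect cert u0 w.
  move=> suv; apply: (connect_trans (y := u0)); last exact: H.
  by rewrite (sym_connect_sym cert_sym); exact: H.
have lW : l <= W by lia.
have K0 : 0 < K by lia.
have all_lt : all (fun y => y < W) (iota 0 l).
  by apply/allP => y; rewrite mem_iota; lia.
have [|u0 [su0 u0l]] := @hit_side (u \in V1) 0 (iota 0 l) K0 (iota_uniq _ _) all_lt.
  by rewrite size_iota.
exists u0 => w; move Ek : (c w) => k.
elim: k {-2}k (leqnn k) w Ek => [|k IH] k' kk w cw sw.
  apply: (window_cert K0).
  - by rewrite (eqP su0).
  - by move: u0l; rewrite mem_iota; lia.
  - by have := offset_cases K 0 (c w); lia.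
have [kl|kl] := leqP k' l.
  apply: (window_cert K0).
  - by rewrite (eqP su0).
  - by move: u0l; rewrite mem_iota; lia.
  - by have := offset_cases K 0 (c w); lia.
have iK : k' - l < K by have := c_lt w; lia.
have [|a [sa al]] := @hit_side (u \in V1) (k' - l) (iota 0 l) iK (iota_uniq _ _) all_lt.
  by rewrite size_iota.
rewrite mem_iota in al.
apply: (connect_trans (y := a)).
  apply: (IH (c a)) => //; last by rewrite eq_sym.
  have := c_lt a; have := c_lt w; have := offset_cases K (k' - l) (c a); lia.
apply: (window_cert iK).
- by rewrite (eqP sa).
- lia.
- by have := offset_cases K (k' - l) (c w); lia.
Qed.

End Recovery.

(** * Large deviations of cell counts *)

Lemma exists_offset K i y : i < K -> y < K -> exists2 k, k < K & offset K i k = y.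
Proof.
move=> iK yK; have [iy|iy] := ltnP (i + y) K.
  by exists (i + y); [|have := offset_cases K i (i + y)]; lia.
by exists (i + y - K); [|have := offset_cases K i (i + y - K)]; lia.
Qed.

Lemma card_offset K i r : i < K -> uniq r -> all (fun y => y < K) r ->
  #|[set k : 'I_K | offset K i k \in r]%SET| = size r.
Proof.
move=> iK ur rK; rewrite cardE -(size_map (fun k : 'I_K => offset K i k)).
apply: perm_size; apply: uniq_perm => //.
  rewrite map_inj_uniq ?enum_uniq // => k k' kk'; apply: val_inj => /=.
  have := offset_cases K i k; have := offset_cases K i k'; have := ltn_ord k.
  have := ltn_ord k'; move: kk' => /=; lia.
move=> y; apply/mapP/idP => [[k + ->]|yr]; first by rewrite mem_enum inE.
have [k kK ky] := exists_offset iK (allP rK _ yr).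
by exists (Ordinal kK); rewrite ?mem_enum ?inE /= ky.
Qed.

Lemma eq_hits n (V1 : {set 'I_n}) K c i r1 r0 r1' r0' :
  r1 =i r1' -> r0 =i r0' -> hits V1 K c i r1 r0 = hits V1 K c i r1' r0'.
Proof.
move=> e1 e0; apply: eq_card => v; rewrite !inE.
by case: ifP => _; rewrite ?e1 ?e0.
Qed.

Local Open Scope ring_scope.

Section Counting.
Variables (R : realType) (n K : nat) (V1 : {set 'I_n}).
Implicit Types c : {ffun 'I_n -> 'I_K}.

(** The probability of S for a uniform random function from vertices to cells. *)
Definition proportion (S : {set {ffun 'I_n -> 'I_K}}) : R := #|S|%:R / (K ^ n)%:R.

Lemma proportion_le (S S' : {set {ffun 'I_n -> 'I_K}}) :
  S \subset S' -> proportion S <= proportion S'.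
Proof.
by move=> SS; rewrite /proportion ler_wpM2r ?invr_ge0 // ler_nat subset_leq_card.
Qed.

Lemma proportion_bigcup (I : finType) (F : I -> {set {ffun 'I_n -> 'I_K}}) (b : R) :
  (forall i, proportion (F i) <= b) -> proportion (\bigcup_i F i) <= #|I|%:R * b.
Proof.
move=> Fb.
apply: (@le_trans _ _ (\sum_(i : I) proportion (F i))).
  elim/big_ind2 : _ => [|A a B d Aa Bd|//]; first by rewrite /proportion cards0 mul0r.
  apply: le_trans (lerD Aa Bd); rewrite /proportion -mulrDl ler_wpM2r ?invr_ge0 //.
  by rewrite -natrD ler_nat leq_card_setU.
apply: le_trans (ler_sum _ (fun i _ => Fb i)) _.
by rewrite sumr_const mulr_natl.
Qed.

Definition hit_count c i r1 r0 := hits V1 K (fun v => val (c v)) i r1 r0.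

(** The moment generating function of the number of hits: the sum over functions factors over the
    vertices, whose cells are independent. *)
Lemma sum_expR_hits lam i r1 r0 : (i < K)%N -> uniq r1 -> uniq r0 ->
  all (fun y => y < K)%N r1 -> all (fun y => y < K)%N r0 ->
  \sum_c expR (lam * (hit_count c i r1 r0)%:R) <=
  (K ^ n)%:R * expR ((expR lam - 1) *
    (#|V1| * size r1 + (n - #|V1|) * size r0)%:R / K%:R) :> R.
Proof.
move=> iK u1 u0 a1 a0.
pose r v := if v \in V1 then r1 else r0.
pose F v (k : 'I_K) : R := if offset K i k \in r v then expR lam else 1.
have -> : \sum_c expR (lam * (hit_count c i r1 r0)%:R) =
    \sum_(c : {ffun 'I_n -> 'I_K}) \prod_v F v (c v).
  apply: eq_bigr => c _; rewrite mulrC expRM_natl /F -big_mkcond /=.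
  rewrite prodr_const; congr (_ ^+ _).
  by rewrite /hit_count /hits; apply: eq_card => v; rewrite !inE.
rewrite -bigA_distr_bigA /=.
have KR : K%:R != 0 :> R by rewrite pnatr_eq0; lia.
have Fsum v : \sum_k F v k = K%:R * (1 + (expR lam - 1) * (size (r v))%:R / K%:R).
  have -> : \sum_k F v k = \sum_(k < K) (1 + (if offset K i k \in r v then expR lam - 1 else 0)).
    by apply: eq_bigr => k _; rewrite /F; case: ifP => _; rewrite ?addr0 // addrC subrK.
  rewrite big_split /= sumr_const card_ord -big_mkcond /= sumr_const.
  rewrite mulrDr mulr1 mulrCA mulfV // mulr1 -[(_ - _) *+ _]mulr_natr.
  congr (_ + _ * _%:R).
  rewrite -(@card_offset K i) //; first by apply: eq_card => k; rewrite inE.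
    by rewrite /r; case: ifP.
  by rewrite /r; case: ifP.
rewrite (eq_bigr _ (fun v _ => Fsum v)) big_split /= prodr_const card_ord natrX.
rewrite ler_wpM2l ?exprn_ge0 //.
have -> : (expR lam - 1) * (#|V1| * size r1 + (n - #|V1|) * size r0)%:R / K%:R =
   \sum_v (expR lam - 1) * (size (r v))%:R / K%:R :> R.
  rewrite -mulr_suml -mulr_sumr; congr (_ * _ / _).
  rewrite -natr_sum; congr (_%:R); rewrite (bigID (mem V1)) /=.
  congr (_ + _)%N.
    rewrite (eq_bigr (fun=> size r1)) ?sum_nat_const // => v vV.
    by rewrite /r vV.
  rewrite (eq_bigr (fun=> size r0)); last by move=> v /negbTE vV; rewrite /r vV.
  rewrite sum_nat_const; congr (_ * _)%N.
  transitivity #|predC (mem V1)|; last by apply: eq_card => v; rewrite !inE.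
  have : (#|V1| + #|predC (mem V1)|)%N = n by rewrite -[RHS]card_ord; exact: cardC.
  by move: #|V1| #|predC (mem V1)| => j k; lia.
(* Each factor is bounded by 1 + y <= expR y. Its nonnegativity remains, which for negative [lam]
   uses that [r v] has at most K elements. *)
rewrite expR_sum; apply: ler_prod => v _; rewrite expR_ge1Dx andbT.
have rK : (size (r v) <= K)%N.
  have := max_card (mem [set k : 'I_K | offset K i k \in r v]%SET).
  by rewrite card_ord card_offset // /r; case: ifP.
have : (size (r v))%:R / K%:R <= 1 :> R.
  by rewrite ler_pdivrMr ?mul1r ?ler_nat // ltr0n; lia.
have : 0 <= (size (r v))%:R / K%:R :> R by rewrite divr_ge0.
have := expR_gt0 lam; rewrite -mulrA.
move: (_ / _) => t l0 t0 t1; nra.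
Qed.

(** Markov's inequality for the exponential of [lam] times the number of hits; the sign of [lam]
    selects the upper or the lower tail. *)
Lemma tail_bound lam x i r1 r0 : (i < K)%N -> uniq r1 -> uniq r0 ->
  all (fun y => y < K)%N r1 -> all (fun y => y < K)%N r0 ->
  proportion [set c | lam * x <= lam * (hit_count c i r1 r0)%:R]%SET <=
  expR ((expR lam - 1) * (#|V1| * size r1 + (n - #|V1|) * size r0)%:R / K%:R
        - lam * x).
Proof.
move=> iK u1 u0 a1 a0; have := sum_expR_hits lam iK u1 u0 a1 a0.
set A := (X in proportion X); set B := (X in _ <= _ * expR X) => H.
have KR : 0 < (K ^ n)%:R :> R by rewrite ltr0n expn_gt0; lia.
rewrite expRD expRN ler_pdivlMr ?expR_gt0 // /proportion mulrAC ler_pdivrMr //.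
rewrite [leRHS]mulrC; apply: le_trans H.
rewrite mulr_natl -sumr_const.
rewrite [leRHS](bigID (mem A)) /= -[leLHS]addr0; apply: lerD.
  by apply: ler_sum => c; rewrite inE => cA; rewrite ler_expR.
by apply: sumr_ge0 => c _; exact: expR_ge0.
Qed.

End Counting.

Local Open Scope classical_set_scope.

Section Bad.
Variables (R : realType) (n K : nat) (V1 : {set 'I_n}).

(* [lam * x <= lam * N] reads [N >= x] for [lam > 0], [N <= x] for [lam < 0]. *)
Definition deviates W (lam x : R) (cond : pred nat) (c : {ffun 'I_n -> 'I_K}) :=
  exists i r1 r0, [/\ window K W i r1 r0, cond (size r1 + size r0)%N &
    lam * x <= lam * (hit_count V1 c i r1 r0)%:R :> R].

Definition bad W (lam x : R) (cond : pred nat) :=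
  [set c : {ffun 'I_n -> 'I_K} | `[< deviates W lam x cond c >]]%SET.

(** Union bound over the base and the two sets of offsets. The lists may be replaced by subsets of
    ['I_W], as hits depend only on membership. With [W] constant, only the factor K grows. *)
Lemma bad_le W (lam x : R) (cond : pred nat) (b : R) : (W <= K)%N -> 0 <= b ->
  (forall s, cond s ->
    expR ((expR lam - 1) * (#|V1| * s)%:R / K%:R - lam * x) <= b) ->
  (#|V1| + #|V1| = n)%N ->
  proportion R (bad W lam x cond) <= (K * (2 ^ W * 2 ^ W))%:R * b.
Proof.
move=> WK b0 Hb cV.
pose vals (J : {set 'I_W}) := [seq val j | j <- enum J].
pose F (p : 'I_K * ({set 'I_W} * {set 'I_W})) : {set {ffun 'I_n -> 'I_K}} :=
  if cond (#|p.2.1| + #|p.2.2|)%N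
  then [set c | lam * x <= lam * (hit_count V1 c p.1 (vals p.2.1) (vals p.2.2))%:R]%SET
  else finset.set0.
have size_vals J : size (vals J) = #|J| by rewrite size_map cardE.
have uniq_vals J : uniq (vals J).
  by rewrite map_inj_uniq ?enum_uniq //; exact: val_inj.
have vals_lt J : all (fun y => y < K)%N (vals J).
  by apply/allP => _ /mapP[j _ ->]; apply: leq_trans (ltn_ord j) WK.
have -> : (K * (2 ^ W * 2 ^ W) = #|{: 'I_K * ({set 'I_W} * {set 'I_W})}|)%N.
  by rewrite !card_prod card_ord -!cardsT -powersetT card_powerset cardsT card_ord.
apply: (@le_trans _ _ (proportion R (\bigcup_p F p)%SET)); last first.
  apply: proportion_bigcup.
  move=> [i [J1 J0]]; rewrite /F /=; case: ifP => [cJ|_]; last first.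
    by rewrite /proportion cards0 mul0r.
  apply: le_trans; first by apply: tail_bound; rewrite ?vals_lt.
  apply: le_trans (Hb _ cJ).
  rewrite !size_vals (_ : (n - #|V1|)%N = #|V1|) -?mulnDr //.
  by move: (#|V1|) cV => k; lia.
apply: proportion_le; apply/fintype.subsetP => c; rewrite inE => /asboolP.
move=> [i [r1 [r0 [/and5P[iK u1 u0 a1 a0] cs dev]]]].
pose J (r : seq nat) := [set j : 'I_W | val j \in r]%SET.
have memJ r : all (fun y => y < W)%N r -> vals (J r) =i r.
  move=> ar y; apply/mapP/idP => [[j + ->]|yr]; first by rewrite mem_enum inE.
  by exists (Ordinal (allP ar _ yr)); rewrite ?mem_enum ?inE.
have sizeJ r : uniq r -> all (fun y => y < W)%N r -> #|J r| = size r.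
  by move=> ur ar; rewrite -size_vals; apply: perm_size; apply: uniq_perm => //; exact: memJ.
apply/bigcupP; exists (Ordinal iK, (J r1, J r0)) => //.
rewrite /F /= !sizeJ // cs inE.
by rewrite /hit_count (eq_hits _ _ _ _ (memJ _ a1) (memJ _ a0)).
Qed.

End Bad.

(** * Number of cells and vanishing of the bad events *)

Section Asymptotics.
Context {R : realType}.
Local Notation lnn m := (ln (m.*2)%:R : R).

Lemma near_ln (A : R) : \forall m \near \oo, A <= lnn m.
Proof.
near=> m.
have mA : expR A <= m%:R by near: m; exact: nbhs_infty_ger.
have mA' : expR A <= (m.*2)%:R.
  by apply: le_trans mA _; rewrite ler_nat -addnn leq_addr.
by rewrite -ler_expR lnK // posrE; apply: lt_le_trans mA'; exact: expR_gt0.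
Unshelve. all: by end_near. Qed.

(** With y = ln n, expR y is the square of expR (y / 2), hence at least (y / 2)^2, which exceeds A y
    once y >= 4 A. *)
Lemma near_ln_le (A : R) : \forall m \near \oo, A * lnn m <= (m.*2)%:R.
Proof.
near=> m.
have A1 : 1 <= lnn m by near: m; exact: near_ln.
have A4 : 4 * A <= lnn m by near: m; exact: near_ln.
have m0 : 0 < (m.*2)%:R :> R.
  rewrite ltr0n; case: (m) A1 => [|k _]; last by rewrite doubleS.
  by rewrite double0 ln0 //; lra.
have nE : (m.*2)%:R = expR (lnn m) :> R by rewrite lnK.
rewrite [leRHS]nE; set y := lnn m in A1 A4 *.
have : expR y = expR (y / 2) * expR (y / 2) by rewrite -expRD; congr expR; lra.
have := expR_ge1Dx (y / 2); move: (expR (y / 2)) => z hz ->.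
have h1 : A * y <= (y / 2) * (y / 2) by nra.
by apply: le_trans h1 _; apply: ler_pM; lra.
Unshelve. all: by end_near. Qed.

Variable M : nat.
Hypothesis M_gt0 : (0 < M)%N.

(** With n = 2m vertices, a cell contains on average about ln n / M vertices, half of them in each
    part. *)
Definition num_cells m := Num.truncn (M%:R * (m.*2)%:R / lnn m).

Lemma near_cells (delta : R) (A : nat) : 0 < delta -> \forall m \near \oo,
  [/\ 1 <= lnn m, (A <= num_cells m)%N, (0 < num_cells m)%N, (0 < m)%N &
   (num_cells m)%:R * lnn m <= M%:R * (m.*2)%:R <= (1 + delta) * (num_cells m)%:R * lnn m].
Proof.
move=> d0; near=> m.
have A1 : 1 <= lnn m by near: m; exact: near_ln.
(* With more than 1 / delta cells, the truncation costs a relative error of at most delta. *)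
pose B := (Num.truncn delta^-1 + A + 1)%N.
have lnB : (B%:R + 1) * lnn m <= (m.*2)%:R by near: m; exact: near_ln_le.
have l0 : 0 < lnn m by lra.
have MR : 1 <= M%:R :> R by rewrite ler1n.
set x := M%:R * (m.*2)%:R / lnn m.
have xl : x * lnn m = M%:R * (m.*2)%:R by rewrite /x divfK // gt_eqF.
have Bx : B%:R + 1 <= x.
  rewrite /x ler_pdivlMr //; apply: le_trans lnB _.
  by rewrite ler_peMl.
have x0 : 0 <= x by have : 0 <= B%:R :> R by []; lra.
have /andP[Kx xK] := truncn_itv x0; rewrite -/(num_cells m) in Kx xK.
have BK : (B < num_cells m)%N.
  by rewrite /num_cells truncn_ge_nat // -natr1.
have m0 : (0 < m)%N.
  by case: (m) A1 => // A1; rewrite double0 ln0 // in A1; lra.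
split=> //; [lia|lia|].
rewrite -xl; apply/andP; split; apply: ler_wpM2r; rewrite ?(ltW l0) //.
rewrite mulrDl mul1r.
apply: ltW; apply: lt_le_trans xK _; rewrite -natr1 lerD2l.
have : delta^-1 <= (num_cells m)%:R.
  apply: le_trans (ltW (truncnS_gt _)) _; rewrite ler_nat.
  by apply: leq_trans BK; rewrite ltnS /B -addnA leq_addr.
by rewrite -[delta^-1]mul1r ler_pdivrMr // mulrC.
Unshelve. all: by end_near. Qed.

(** There are O(n) events, each of probability O(n^-rho) with rho > 1. The constant C shifts the
    threshold and only affects the implied constant. *)
Lemma bad_vanish (W : nat) (lam tau C delta rho eps : R) (cond : pred nat) :
  0 < delta -> 1 < rho -> 0 < eps ->
  (forall s t, cond s -> (2 * M%:R)^-1 <= t <= (1 + delta) * (2 * M%:R)^-1 ->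
     rho <= lam * tau - (expR lam - 1) * s%:R * t) ->
  \forall m \near \oo, forall V1 : {set 'I_(m.*2)}, #|V1| = m ->
    proportion R (bad (num_cells m) V1 W lam (tau * lnn m + C) cond) <= eps.
Proof.
move=> d0 r1 e0 rate; near=> m => V1 cV.
have [l1 WK K0 m0 /andP[Kl Ku]] : [/\ 1 <= lnn m, (W <= num_cells m)%N,
    (0 < num_cells m)%N, (0 < m)%N &
   (num_cells m)%:R * lnn m <= M%:R * (m.*2)%:R <= (1 + delta) * (num_cells m)%:R * lnn m].
  by near: m; exact: near_cells.
pose Z := M%:R * (2 ^ W * 2 ^ W)%:R * expR (- lam * C).
(* This makes Z n^(1 - rho), the final bound, at most eps. *)
have lZ : ln (Z / eps) / (rho - 1) <= lnn m by near: m; exact: near_ln.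
have MR : 0 < M%:R :> R by rewrite ltr0n.
have Z0 : 0 < Z by rewrite /Z !mulr_gt0 ?expR_gt0 // ltr0n muln_gt0 !expn_gt0.
have nE : (m.*2)%:R = expR (lnn m) :> R.
  by rewrite lnK // posrE ltr0n double_gt0.
set y := lnn m in l1 Kl Ku lZ nE *; set K := num_cells m in K0 WK Kl Ku *.
have KR : 0 < K%:R :> R by rewrite ltr0n.
(* The mean number of vertices of one part in one cell, in units of ln n. *)
pose t := m%:R / (K%:R * y).
have y0 : 0 < y by lra.
have m2 : (m.*2)%:R = 2 * m%:R :> R by rewrite -mul2n natrM.
have tb : (2 * M%:R)^-1 <= t <= (1 + delta) * (2 * M%:R)^-1.
  rewrite m2 in Kl Ku; have Ky : 0 < K%:R * y by rewrite mulr_gt0.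
  have MM : 0 < 2 * M%:R :> R by rewrite mulr_gt0.
  apply/andP; split; rewrite /t.
    by rewrite ler_pdivlMr // mulrC ler_pdivrMr //; lra.
  by rewrite ler_pdivlMr // mulrAC ler_pdivrMr //; lra.
apply: le_trans (@bad_le R _ K V1 W lam _ cond (expR (- (rho * y) - lam * C)) _ _ _ _) _ => //.
- move=> s cs; rewrite ler_expR cV.
  have := rate s t cs tb; rewrite -(ler_pM2r y0) => H.
  rewrite -[X in X - _ <= _]mulrA.
  have -> : (m * s)%:R / K%:R = s%:R * t * y :> R.
    rewrite /t natrM; field; apply/andP; split; lra.
  lra.
- by rewrite cV addnn.
rewrite expRD natrM; set Q := (2 ^ W * 2 ^ W)%:R.
have Q0 : 0 < Q :> R by rewrite ltr0n muln_gt0 !expn_gt0.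
have KM : K%:R <= M%:R * expR y.
  rewrite -nE; apply: le_trans Kl; by rewrite ler_peMr.
have -> : expR (- (rho * y)) = expR (- ((rho - 1) * y)) / expR y.
  by rewrite -expRN -expRD; congr expR; lra.
have E : expR (- ((rho - 1) * y)) <= eps / Z.
  rewrite expRN -invf_div lef_pV2 ?posrE ?expR_gt0 ?divr_gt0 //.
  rewrite -[Z / eps]lnK ?posrE ?divr_gt0 // ler_expR.
  by move: lZ; rewrite ler_pdivrMr ?subr_gt0 // => /le_trans; apply; rewrite mulrC.
apply: (@le_trans _ _ (M%:R * expR y * Q * (eps / Z / expR y * expR (- lam * C)))).
  rewrite mulNr; apply: ler_pM; rewrite ?mulr_ge0 ?expR_ge0 ?invr_ge0 ?expR_ge0 //.
  - by rewrite ler_wpM2r // ltW.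
  - by rewrite ler_wpM2r ?expR_ge0 // ler_wpM2r // invr_ge0 expR_ge0.
rewrite le_eqVlt; apply/orP; left; apply/eqP.
rewrite /Z -/Q; field.
by rewrite !gt_eqF ?expR_gt0.
Unshelve. all: by end_near. Qed.

End Asymptotics.

(** * Choice of the constants *)

Section Rates.
Context {R : realType}.
Implicit Types tau mu : R.

(* A Poisson variable of mean [mu ln n] exceeds [tau ln n] (resp. is below it)
   with probability at most n^-(lam tau - (e^lam - 1) mu), for any lam >= 0
   (resp. lam <= 0). *)
Definition up_rate tau mu :=
  exists lam, 0 <= lam /\ 1 < lam * tau - (expR lam - 1) * mu.
Definition low_rate tau mu :=
  exists lam, lam <= 0 /\ 1 < lam * tau - (expR lam - 1) * mu.

Lemma up_rate_le tau mu tau' mu' : tau <= tau' -> mu' <= mu ->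
  up_rate tau mu -> up_rate tau' mu'.
Proof.
move=> tt mm [lam [l0 H]]; exists lam; split => //.
have := expR_ge1Dx lam; move: (expR lam) H => z H hz; nra.
Qed.

Lemma low_rate_le tau mu tau' mu' : tau' <= tau -> mu <= mu' ->
  low_rate tau mu -> low_rate tau' mu'.
Proof.
move=> tt mm [lam [l0 H]]; exists lam; split => //.
have : expR lam <= 1 by rewrite -expR0 ler_expR.
move: (expR lam) H => z H hz; nra.
Qed.

Lemma slack (x y g : R) : 0 < g -> exists2 e, 0 < e & x * e + y * e < g.
Proof.
move=> g0; pose d := `|x| + `|y| + 1.
have d0 : 0 < d by rewrite /d; have := normr_ge0 x; have := normr_ge0 y; lra.
exists (g / d); first by rewrite divr_gt0.
rewrite -mulrDl mulrA ltr_pdivrMr // mulrC ltr_pM2l // /d.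
have := ler_norm x; have := ler_norm y; lra.
Qed.

(** For fixed [lam] the condition is a strict inequality, affine in tau and mu. *)
Lemma up_rate_open tau mu : up_rate tau mu ->
  exists2 e, 0 < e & up_rate (tau - e) (mu + e).
Proof.
move=> [lam [l0 H]].
have g0 : 0 < lam * tau - (expR lam - 1) * mu - 1 by lra.
have [e e0 He] := slack lam (expR lam - 1) g0.
by exists e => //; exists lam; split => //; lra.
Qed.

Lemma low_rate_open tau mu : low_rate tau mu ->
  exists2 e, 0 < e & low_rate (tau + e) (mu - e).
Proof.
move=> [lam [l0 H]].
have g0 : 0 < lam * tau - (expR lam - 1) * mu - 1 by lra.
have [e e0 He] := slack (- lam) (- (expR lam - 1)) g0.
by exists e => //; exists lam; split => //; lra.
Qed.

(** The exponent is largest at [lam] = ln (tau / mu), where it is the expression appearing in [t1]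
    and, halved and rescaled, in [theta2]. *)
Lemma up_rate_entropy tau mu : 0 < mu <= tau ->
  1 < tau * ln (tau / mu) - tau + mu -> up_rate tau mu.
Proof.
move=> /andP[m0 mt] H; exists (ln (tau / mu)); split.
  by rewrite ln_ge0 // ler_pdivlMr // mul1r.
rewrite lnK ?posrE ?divr_gt0 //; last by apply: lt_le_trans mt.
by rewrite mulrBl divfK ?gt_eqF //; lra.
Qed.

Lemma low_rate_entropy tau mu : 0 < tau <= mu ->
  1 < tau * ln (tau / mu) - tau + mu -> low_rate tau mu.
Proof.
move=> /andP[t0 tm] H; have m0 : 0 < mu by lra.
exists (ln (tau / mu)); split.
  by rewrite ln_le0 // ler_pdivrMr // mul1r.
rewrite lnK ?posrE ?divr_gt0 //.
by rewrite mulrBl divfK ?gt_eqF //; lra.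
Qed.

(** The exponent is at most (1 - expR lam) mu, hence at most mu. *)
Lemma low_rate_mean tau mu : 0 <= tau -> low_rate tau mu -> 0 <= mu -> 1 < mu.
Proof.
move=> t0 [lam [l0 H]] m0; have := expR_gt0 lam.
move: (expR lam) H => z H z0; nra.
Qed.

Section Thresholds.
Variables a b : R.
Hypotheses (b_gt0 : 0 < b) (ab : 2 * b <= a).

Lemma t1_has_inf : has_inf
  [set t | 0 <= t /\ (2 * b + t) * ln ((2 * b + t) / (2 * b)) - t > 1].
Proof.
have b0 := b_gt0; have ab' := ab.
split; last by exists 0 => t [].
(* This t makes the ratio at least expR 2 and the logarithm at least 2, so the expression is at
   least 4 b + t. *)
pose t : R := 2 * b * (expR 2 - 1) + 1.
have E1 : 1 < expR 2 :> R by rewrite expR_gt1.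
have tE : 2 * b + t = 2 * b * expR 2 + 1 by rewrite /t; ring.
have t0 : 1 <= t.
  have : 0 < b * (expR 2 - 1) by rewrite mulr_gt0 // subr_gt0.
  by rewrite /t; lra.
have bt : 0 < b * expR 2 by rewrite mulr_gt0 // expR_gt0.
have hz : 2 <= ln ((2 * b + t) / (2 * b)).
  rewrite -[leLHS]expRK ler_ln ?posrE ?expR_gt0 ?divr_gt0 ?mulr_gt0 //; last lra.
  by rewrite ler_pdivlMr ?mulr_gt0 //; lra.
exists t; split; first lra.
have : 0 <= (2 * b + t) * (ln ((2 * b + t) / (2 * b)) - 2).
  by rewrite mulr_ge0 // ?subr_ge0 //; lra.
by rewrite mulrBr; lra.
Qed.

Lemma t1_ge0 : 0 <= t1 b.
Proof.
have b0 := b_gt0; have ab' := ab.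
by apply: lb_le_inf; [exact: t1_has_inf.1 | move=> ? []]. Qed.

(** The infimum need not satisfy the strict inequality, but points of the set arbitrarily close to
    it do. *)
Lemma t1_adherent (e : R) : 0 < e ->
  exists t, [/\ 0 <= t, t1 b <= t < t1 b + e & up_rate (2 * b + t) (2 * b)].
Proof.
have b0 := b_gt0; have ab' := ab.
move=> e0; have [t [t0 Ht] te] := inf_adherent e0 t1_has_inf.
exists t; split=> //.
  by rewrite te andbT; apply: ge_inf => //; exact: t1_has_inf.2.
by apply: up_rate_entropy; lra.
Qed.

Lemma t2_ge0 : 0 <= t2 b.
Proof.
have b0 := b_gt0; have ab' := ab.
apply: lb_le_inf; first by exists (2 * b); right.
by move=> t [[/andP[]]|->] //; lra.
Qed.

Lemma t2_adherent (e : R) : 0 < e -> t2 b < 2 * b ->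
  exists t, [/\ 0 <= t < 2 * b, t2 b <= t < t2 b + e &
    low_rate (2 * b - t) (2 * b)].
Proof.
have b0 := b_gt0; have ab' := ab.
move=> e0 t2b; rewrite /t2; set S := (_ `|` _).
have Sinf : has_inf S.
  split; first by exists (2 * b); right.
  by exists 0 => t [[/andP[]]|->] //; lra.
(* The second bound excludes the adjoined endpoint 2 b. *)
have e'0 : 0 < Num.min e (2 * b - t2 b) by rewrite lt_min e0 subr_gt0.
have [t St] := inf_adherent e'0 Sinf.
have -> : inf S = t2 b by [].
rewrite -ltrBlDl lt_min => /andP[te tb].
exists t; case: St => [[/andP[t0 t2b'] Ht]|tE]; last by rewrite tE in tb; lra.
split; [lra| |].
  apply/andP; split; last lra.
  by apply: ge_inf; [exact: Sinf.2 | left; rewrite /= t0 t2b'].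
by apply: low_rate_entropy; lra.
Qed.

(** Distributing the factor 1/2 gives the entropy inequality for the threshold 2 b + t1 and the mean
    a - theta / 2 of the common neighbours inside a part. *)
Lemma theta1_rate theta : 0 <= theta <= 2 * a - 4 * b - 2 * t1 b ->
  2^-1 * ((4 * b + 2 * t1 b) * ln ((4 * b + 2 * t1 b) / (2 * a - theta))
    + 2 * a - theta - 4 * b - 2 * t1 b) > 1 ->
  low_rate (2 * b + t1 b) (a - theta / 2).
Proof.
have b0 := b_gt0; have ab' := ab.
move=> th H; have := t1_ge0 => t10.
apply: low_rate_entropy; first lra.
suff <- : (4 * b + 2 * t1 b) / (2 * a - theta) = (2 * b + t1 b) / (a - theta / 2).
  by move: H; move: (ln _) => z; lra.
by field; lra.
Qed.

Lemma theta2_rate theta : Num.max (2 * b) (2 * a - 4 * b + 2 * t2 b) <= theta <= a ->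
  2^-1 * ((4 * b - 2 * t2 b) * ln ((4 * b - 2 * t2 b) / (2 * a - theta))
    + 2 * a - theta - 4 * b + 2 * t2 b) > 1 ->
  t2 b < 2 * b /\ up_rate (2 * b - t2 b) (a - theta / 2).
Proof.
have b0 := b_gt0; have ab' := ab.
rewrite ge_max => /andP[/andP[th1 th2] th3] H.
have t2b : t2 b < 2 * b by lra.
split=> //; apply: up_rate_entropy; first lra.
suff <- : (4 * b - 2 * t2 b) / (2 * a - theta) = (2 * b - t2 b) / (a - theta / 2).
  by move: H; move: (ln _) => z; lra.
by field; lra.
Qed.

(** The rate at a point theta near the infimum has some slack, spent on replacing [t2 b] by a nearby
    t with a genuine rate; the shift by e / 2 makes [2 * b < theta2'] strict. The alternative tau2 =
    0 means that no long edge is used. *)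
Lemma theta2_adherent (e : R) : 0 < e -> exists tau2 theta2' : R, [/\ 0 <= tau2,
   0 <= theta2', theta2' <= theta2 a b + e, theta2' <= a & 
   (tau2 = 0 /\ theta2' = a) \/ [/\ low_rate tau2 (2 * b), 2 * b < theta2',
     2 * a - 4 * b <= theta2' & up_rate tau2 (a - theta2' / 2)]].
Proof.
have b0 := b_gt0; have ab' := ab.
move=> e0; have e20 : 0 < e / 2 by lra.
pose S := [set theta |
         2^-1 * ((4 * b - 2 * t2 b) *
                   ln ((4 * b - 2 * t2 b) / (2 * a - theta))
                 + 2 * a - theta - 4 * b + 2 * t2 b) > 1 /\
         Num.max (2 * b) (2 * a - 4 * b + 2 * t2 b) <= theta <= a]
       `|` [set a].
have Sinf : has_inf S.
  split; first by exists a; right.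
  exists 0 => t [[_]|->]; last lra.
  by rewrite ge_max => /andP[/andP[]]; lra.
have [theta Sth] := inf_adherent e20 Sinf; rewrite -/(theta2 a b) => th.
have [a_th|th_a] := leP a (theta + e / 2).
  by exists 0, a; split=> //; try lra; left.
case: Sth => [[H1 H2]|/= tha]; last by lra.
have [t2b up] := theta2_rate H2 H1.
have [d d0 up'] := up_rate_open up.
have [t [t0 td low]] := t2_adherent d0 t2b.
exists (2 * b - t), (theta + e / 2).
move: H2; rewrite ge_max => /andP[/andP[th1 th2] th3].
have := t2_ge0 => t20.
split; try lra.
right; split => //; try lra.
by apply: up_rate_le up'; lra.
Qed.

Lemma theta1_adherent (e : R) : 0 < e -> exists tau1 theta1' : R, [/\ 0 <= tau1,
   up_rate tau1 (2 * b), 0 <= theta1', theta1 a b - e <= theta1' &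
   theta1' = 0 \/ [/\ theta1' <= 2 * a - 4 * b & low_rate tau1 (a - theta1' / 2)]].
Proof.
have b0 := b_gt0; have ab' := ab.
move=> e0; pose S := [set theta |
         2^-1 * ((4 * b + 2 * t1 b) *
                   ln ((4 * b + 2 * t1 b) / (2 * a - theta))
                 + 2 * a - theta - 4 * b - 2 * t1 b) > 1 /\
         0 <= theta <= 2 * a - 4 * b - 2 * t1 b]
       `|` [set 0].
have := t1_ge0 => t10.
have Ssup : has_sup S.
  split; first by exists 0; right.
  exists (2 * a) => t [[_ /andP[_ h]]|->]; lra.
have [theta Sth] := sup_adherent e0 Ssup; rewrite -/(theta1 a b) => th.
case: Sth => [[H1 H2]|/= th0]; last first.
  have [t [t0 _ up]] := t1_adherent ltr01.
  by exists (2 * b + t), 0; split=> //; try lra; left.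
have [d d0 low] := low_rate_open (theta1_rate H2 H1).
have [t [t0 td up]] := t1_adherent d0.
exists (2 * b + t), theta; split=> //; try lra.
by right; split; [lra | apply: low_rate_le low; lra].
Qed.

Lemma parameters :
  a - theta2 a b + theta1 a b > 2 \/ (a - theta2 a b > 1 /\ a > 2) ->
  exists tau1 tau2 th1 th2 : R, [/\ 0 <= tau1, 0 <= tau2, up_rate tau1 (2 * b),
    0 <= th1 /\ th1 <= th2 /\ th2 <= a &
    th1 = 0 \/ low_rate tau1 (a - th1 / 2)] /\
  ((tau2 = 0 /\ th2 = a) \/
    [/\ low_rate tau2 (2 * b), 2 * b < th2 & up_rate tau2 (a - th2 / 2)]) /\
  (a - th2 + th1 > 2 \/ (a - th2 > 1 /\ a > 2)).
Proof.
have b0 := b_gt0; have ab' := ab.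
case=> [H|[H a2]].
  pose e := (a - theta2 a b + theta1 a b - 2) / 3.
  have e0 : 0 < e by rewrite /e; lra.
  have [tau1 [th1 [t10 up1 th10 th1e low1]]] := theta1_adherent e0.
  have [tau2 [th2 [t20 th20 th2e th2a up2]]] := theta2_adherent e0.
  have [th12|th12] := leP th1 th2.
    exists tau1, tau2, th1, th2; split; first split => //.
      by case: low1 => [|[]]; [left|right].
    split; first by case: up2 => [|[]]; [left|right].
    by left; rewrite /e in th1e th2e; lra.
  case: low1 => [|[th1' low1]]; first lra.
  case: up2 => [[tau20 th2A]|[_ _]]; last lra.
  (* Here th2 = a < th1: short edges alone cover all lengths, so both bounds become a. That a > 2
     follows from [low_rate_mean]. *)
  exists tau1, 0, a, a; split; first split => //.
  - by split; lra.
  - by right; apply: low_rate_le low1; lra.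
  split; first by left.
  left; have := low_rate_mean t10 low1; lra.
pose e := (a - theta2 a b - 1) / 2.
have e0 : 0 < e by rewrite /e; lra.
have [tau1 [th1 [t10 up1 _ _ _]]] := theta1_adherent e0.
have [tau2 [th2 [t20 th20 th2e th2a up2]]] := theta2_adherent e0.
exists tau1, tau2, 0, th2; split; first by split => //; left.
split; first by case: up2 => [|[]]; [left|right].
by right; split => //; rewrite /e in th2e; lra.
Qed.

End Thresholds.
End Rates.

(** * Rounding lengths and thresholds to integers *)

Lemma count_two_intervals (s1 s2 D : nat) : (0 < s2)%N -> (s1 <= s2)%N ->
  (s1 <= D.+1)%N ->
  (s1 - 1 + (D.+1 - s2) <= count (fun d => (d < s1) || (s2 <= d <= D)) (iota 1 D))%N.
Proof.
move=> s20 s12 s1D; rewrite -size_filter.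
rewrite -(size_iota 1 (s1 - 1)) -(size_iota s2 (D.+1 - s2)) -size_cat.
apply: uniq_leq_size.
  rewrite cat_uniq !iota_uniq andbT /=; apply/hasPn => d; rewrite !mem_iota; lia.
move=> d; rewrite mem_cat mem_filter !mem_iota; lia.
Qed.

Lemma truncn_bounds (R : realType) (y : R) : 0 <= y ->
  (Num.truncn y)%:R <= y /\ y < (Num.truncn y)%:R + 1.
Proof. by move=> /truncn_itv/andP[? ?]; rewrite natr1. Qed.

(** Lengths are measured in cells, and margins of 100 cells absorb all the roundings. *)
Lemma grid_bounds (R : realType) (X Y T1 T2 x h : R) :
  100 <= Y -> 2 * Y <= X -> 0 <= T1 <= T2 -> T2 <= X -> 100 <= x -> 100 <= h ->
  T1 = 0 \/ 100 <= T1 ->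
  2 * x + 4 * h <= X - T2 + T1 \/ (x + 2 * h <= X - T2 /\ 2 * x + 4 * h <= X) ->
  let alpha := Num.truncn X in let beta := Num.truncn Y in
  let A1 := Num.truncn T1 in let A2 := Num.truncn T2 in
  let l := Num.truncn (2 * x + 2 * h) in
  [/\ (2 * beta <= alpha)%N, (8 <= beta)%N, (A1 <= A2)%N /\ (A2 <= alpha)%N,
    A1 = 0%N \/ (6 <= A1)%N &
    (l.+1 + 10 + A2 <= A1 + alpha)%N \/
    (l.+1 + 20 + 2 * A2 <= 2 * alpha)%N /\ (l.+1 + 10 <= alpha)%N].
Proof.
move=> Y100 YX /andP[T10 T12] T2X x100 h100 T1c Hx.
have [Y0 X0 T20 l0] : [/\ 0 <= Y, 0 <= X, 0 <= T2 & 0 <= 2 * x + 2 * h].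
  by clear T1c Hx; split; lra.
have [al1 al2] := truncn_bounds X0; have [be1 be2] := truncn_bounds Y0.
have [A11 A12] := truncn_bounds T10; have [A21 A22] := truncn_bounds T20.
have [l1 l2] := truncn_bounds l0.
move: (Num.truncn X) (Num.truncn Y) (Num.truncn T1) (Num.truncn T2)
  (Num.truncn (2 * x + 2 * h)) al1 al2 be1 be2 A11 A12 A21 A22 l1 l2.
move=> al be A1 A2 l al1 al2 be1 be2 A11 A12 A21 A22 l1 l2 /=.
have S k : k.+1%:R = k%:R + 1 :> R by rewrite natr1.
split.
- by rewrite -ltnS -(ltr_nat R) S natrM; clear -al2 be1 YX; lra.
- by rewrite -ltnS -(ltr_nat R) S; clear -be2 Y100; lra.
- by split; rewrite -ltnS -(ltr_nat R) S; [clear -A11 A22 T12|clear -A21 al2 T2X]; lra.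
- case: T1c => [T1E|T1c]; [left|right].
    by apply/eqP; rewrite -leqn0 -ltnS -(ltr_nat R); clear -T1E A11; lra.
  by rewrite -ltnS -(ltr_nat R) S; clear -T1c A12; lra.
- case: Hx => [H|[H1 H2]]; [left|right; split].
  + by rewrite -(ler_nat R) !natrD S; clear -H al2 A12 A21 l1 h100; lra.
  + by rewrite -(ler_nat R) !natrD S; clear -H1 al2 A21 l1 h100; lra.
  + by rewrite -(ler_nat R) !natrD S; clear -H2 al2 l1 h100; lra.
Qed.

Section Constants.
Context {R : realType}.

(** The hypothesis of [bad_vanish]: s is a number of cells and t the mean per cell in units of ln n,
    known up to a factor 1 + delta. *)
Definition rate_bound (M : nat) (lam tau : R) (cond : pred nat) :=
  exists delta rho, [/\ 0 < delta, 1 < rho & forall s t, cond s ->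
    (2 * M%:R)^-1 <= t <= (1 + delta) * (2 * M%:R)^-1 ->
    rho <= lam * tau - (expR lam - 1) * s%:R * t].
Definition few (M : nat) (tau : R) s0 := exists lam,
  0 <= lam /\ rate_bound M lam tau (fun s => s <= s0)%N.
Definition many (M : nat) (tau : R) s0 := exists lam,
  lam <= 0 /\ rate_bound M lam tau (fun s => s0 <= s)%N.

Lemma up_rate_few M (tau mu : R) s0 : (0 < M)%N -> s0%:R <= mu * (2 * M%:R) ->
  up_rate tau mu -> few M tau s0.
Proof.
move=> M0 s0m [lam [l0 H]]; exists lam; split => //.
have MR : 0 < M%:R :> R by rewrite ltr0n.
have z1 : 0 <= expR lam - 1 by rewrite subr_ge0 -expR0 ler_expR.
have g0 : 0 < lam * tau - (expR lam - 1) * mu - 1 by lra.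
have [d d0 Hd] := slack 0 ((expR lam - 1) * mu) g0.
exists d, (lam * tau - (expR lam - 1) * (mu * (1 + d))); split=> //; first lra.
move=> s t ss0 /andP[_ td]; rewrite lerD2l lerN2 -mulrA ler_wpM2l //.
apply: (@le_trans _ _ (s0%:R * ((1 + d) * (2 * M%:R)^-1))).
  have t0 : 0 <= (1 + d) * (2 * M%:R)^-1 by rewrite mulr_ge0 ?invr_ge0; lra.
  apply: (@le_trans _ _ (s%:R * ((1 + d) * (2 * M%:R)^-1))).
    by rewrite ler_wpM2l.
  by rewrite ler_wpM2r // ler_nat.
rewrite mulrCA [leRHS]mulrC ler_wpM2l //; first lra.
by rewrite ler_pdivrMr // mulr_gt0.
Qed.

Lemma low_rate_many M (tau mu : R) s0 : (0 < M)%N -> mu * (2 * M%:R) <= s0%:R ->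
  low_rate tau mu -> many M tau s0.
Proof.
move=> M0 s0m [lam [l0 H]]; exists lam; split => //.
have MR : 0 < M%:R :> R by rewrite ltr0n.
have z1 : 0 <= 1 - expR lam by rewrite subr_ge0 -expR0 ler_expR.
exists 1, (lam * tau - (expR lam - 1) * mu); split=> // s t ss0 /andP[td _].
rewrite lerD2l -!mulNr opprB -mulrA ler_wpM2l //.
have t0 : 0 <= (2 * M%:R)^-1 :> R by rewrite invr_ge0; lra.
apply: (@le_trans _ _ (s%:R * (2 * M%:R)^-1)); last by rewrite ler_wpM2l.
apply: (@le_trans _ _ (s0%:R * (2 * M%:R)^-1)); last by rewrite ler_wpM2r // ler_nat.
by rewrite ler_pdivlMr // mulr_gt0.
Qed.

(* [p / (q ln 2)] times [ln n] is [p log2 n / q], the threshold computed by the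
   program. *)
Definition threshold p q : R := p%:R / (q%:R * ln 2).

Let ln2 : 0 < ln 2 :> R. Proof. by rewrite ln_gt0 // ltr1n. Qed.

Lemma threshold_between (tau e : R) : 0 <= tau -> 0 < e ->
  exists p q, (0 < q)%N /\ threshold p q <= tau <= threshold p.+1 q /\
    threshold p.+1 q <= threshold p q + e.
Proof.
move=> t0 e0; have l2 := ln2.
pose q := (Num.truncn (e * ln 2)^-1).+1.
have q0 : 0 < q%:R :> R by rewrite ltr0n.
have ql : 0 < q%:R * ln 2 :> R by rewrite mulr_gt0.
have c0 : 0 <= tau * (q%:R * ln 2) by rewrite mulr_ge0 // ltW.
exists (Num.truncn (tau * (q%:R * ln 2))), q; split=> //.
have /andP[pc cp] := truncn_itv c0.
rewrite /threshold; split.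
  by rewrite ler_pdivrMr // pc ler_pdivlMr // ltW.
rewrite -natr1 mulrDl lerD2l mul1r.
have : (e * ln 2)^-1 < q%:R by rewrite /q truncnS_gt.
rewrite -[(e * ln 2)^-1]mul1r ltr_pdivrMr ?mulr_gt0 // => H.
by rewrite -[(q%:R * _)^-1]mul1r ler_pdivrMr //; lra.
Qed.

(** Threshold 0 concerns sets of empty cells: any mean above 1 suffices, so about 2 M cells of one
    part cannot all be empty. *)
Lemma low_rate0 (eta : R) : 0 < eta -> low_rate 0 (1 + eta).
Proof.
move=> e0; have d0 : 0 < eta / (2 * (1 + eta)) by rewrite divr_gt0 //; lra.
exists (ln (eta / (2 * (1 + eta)))); split.
  by rewrite ln_le0 // ler_pdivrMr; lra.
rewrite lnK // mulr0 mulrBl mul1r.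
have -> : eta / (2 * (1 + eta)) * (1 + eta) = eta / 2 by field; lra.
lra.
Qed.

Variables a b : R.
Hypotheses (b_gt0 : 0 < b) (ab : 2 * b <= a).

(** The first threshold is rounded up and the second down, which preserves the bounds for edges
    between the parts; the slack in the rates for edges inside a part pays for the rounding. *)
Lemma rational_parameters :
  a - theta2 a b + theta1 a b > 2 \/ (a - theta2 a b > 1 /\ a > 2) ->
  exists (p1 q1 p2 q2 : nat) (th1 th2 e : R),
  [/\ (0 < q1)%N, (0 < q2)%N, 0 < e, 0 <= th1 <= th2 & th2 <= a] /\
  [/\ up_rate (threshold p1 q1) (2 * b + e),
     p2 = 0%N \/ low_rate (threshold p2 q2) (2 * b - e),
     th1 = 0 \/ low_rate (threshold p1 q1) (a - th1 / 2 - e),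
     th2 = a \/ (2 * b < th2 /\ up_rate (threshold p2 q2) (a - th2 / 2 + e)) &
     a - th2 + th1 > 2 \/ (a - th2 > 1 /\ a > 2)].
Proof.
have b0 := b_gt0; have ab' := ab.
move=> /(parameters b_gt0 ab)[tau1 [tau2 [th1 [th2]]]].
move=> [[t10 t20 up1 [th10 [th12 th2a]] low1] [H2 H]].
have [e1 e10 low1'] : exists2 e, 0 < e &
    th1 = 0 \/ low_rate (tau1 + e) (a - th1 / 2 - e).
  case: low1 => [->|/low_rate_open[e e0 low]]; first by exists 1 => //; left.
  by exists e => //; right.
have [p1 [q1 [q10 [/andP[p1tau tau1p] p1e]]]] := threshold_between t10 e10.
have up1' : up_rate (threshold p1.+1 q1) (2 * b) by apply: up_rate_le up1.
have [f1 f10 up1f] := up_rate_open up1'.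
have low1f : th1 = 0 \/ low_rate (threshold p1.+1 q1) (a - th1 / 2 - e1).
  by case: low1' => [|low]; [left|right; apply: low_rate_le low => //; lra].
case: H2 => [[_ th2E]|[low2 th2b up2]].
  (* With p2 = 0 the test for few common neighbours never succeeds. *)
  exists p1.+1, q1, 0%N, 1%N, th1, th2, (Num.min e1 f1); split.
    by split; rewrite ?lt_min ?e10 // th10.
  have [me mf] : Num.min e1 f1 <= e1 /\ Num.min e1 f1 <= f1.
    by rewrite !ge_min !lexx orbT.
  split => //; [|by left| |by left].
  - by apply: up_rate_le up1f; lra.
  - by case: low1f => [|low]; [left|right; apply: low_rate_le low; lra].
have [e2 e20 up2'] := up_rate_open up2.
have [p2 [q2 [q20 [/andP[p2tau tau2p] p2e]]]] := threshold_between t20 e20.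
have low2' : low_rate (threshold p2 q2) (2 * b) by apply: low_rate_le low2.
have [f2 f20 low2f] := low_rate_open low2'.
exists p1.+1, q1, p2, q2, th1, th2, (Num.min (Num.min e1 f1) (Num.min e2 f2)); split.
  by split; rewrite ?lt_min ?e10 ?f10 ?e20 // th10.
set m := Num.min _ _.
have [me1 mf1 me2 mf2] : [/\ m <= e1, m <= f1, m <= e2 & m <= f2].
  by rewrite !ge_min !lexx !orbT.
split => //.
- by apply: up_rate_le up1f; lra.
- by right; apply: low_rate_le low2f; lra.
- by case: low1f => [|low]; [left|right; apply: low_rate_le low; lra].
- by right; split => //; apply: up_rate_le up2'; lra.
Qed.

End Constants.

(** For M large every positive margin exceeds 100 cells. Then [s1] and [s2] are th1 and th2 in
    cells, moved slightly to the safe side, and [l] is slightly more than 2 M. *)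
Lemma constants (R : realType) (a b : R) : 0 < b -> 2 * b <= a ->
  a - theta2 a b + theta1 a b > 2 \/ (a - theta2 a b > 1 /\ a > 2) ->
  exists p1 q1 p2 q2 M s1 s2 l : nat,
  let alpha := Num.truncn (a * M%:R) in let beta := Num.truncn (b * M%:R) in
  let D := (alpha - 3)%N in
  let E := fun d => ((d < s1) || (s2 <= d <= D))%N in
  [/\ [/\ (0 < q1)%N, (0 < q2)%N, (0 < M)%N & (0 < l)%N],
     [/\ (2 * beta <= alpha)%N, (8 <= beta)%N, (s1 + 2 <= alpha)%N &
         (2 * beta + 2 < s2)%N],
     exists d, E d /\ E d.+1,
     (l <= count E (iota 1 D))%N \/
       exists s, [/\ forall d, (s <= d <= D)%N -> E d, (l <= 2 * (D.+1 - s))%N & (l <= D)%N] &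
     [/\ few M (threshold p1 q1 : R) (4 * beta + 6)%N,
         p2 = 0%N \/ many M (threshold p2 q2 : R) (4 * beta - 26)%N,
         s1 = 0%N \/ many M (threshold p1 q1 : R) (2 * alpha - 5 - s1)%N,
         (s2 <= D)%N -> few M (threshold p2 q2 : R) (2 * alpha + 3 - s2)%N &
         many M (0 : R) l]].
Proof.
move=> b_gt0 ab /(rational_parameters b_gt0 ab)[p1 [q1 [p2 [q2 [th1 [th2 [e]]]]]]].
move=> [[q10 q20 e0 /andP[th10 th12] th2a] [up1 low2 low1 up2 H]].
have [eta eta0 Heta] : exists2 eta, 0 < eta &
    a - th2 + th1 >= 2 * (1 + 2 * eta) \/
    (a - th2 >= 1 + 2 * eta /\ a >= 2 * (1 + 2 * eta)).
  case: H => [H|[H1 H2]]; first by exists ((a - th2 + th1 - 2) / 4); lra.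
  have [h|h] := leP (a - th2 - 1) (a / 2 - 1).
    by exists ((a - th2 - 1) / 2); lra.
  by exists ((a / 2 - 1) / 2); lra.
suff /filter_ex[M HM] : \forall M \near \oo, exists s1 s2 l : nat,
  let alpha := Num.truncn (a * M%:R) in let beta := Num.truncn (b * M%:R) in
  let D := (alpha - 3)%N in
  let E := fun d => ((d < s1) || (s2 <= d <= D))%N in
  [/\ [/\ (0 < q1)%N, (0 < q2)%N, (0 < M)%N & (0 < l)%N],
     [/\ (2 * beta <= alpha)%N, (8 <= beta)%N, (s1 + 2 <= alpha)%N &
         (2 * beta + 2 < s2)%N],
     exists d, E d /\ E d.+1,
     (l <= count E (iota 1 D))%N \/
       exists s, [/\ forall d, (s <= d <= D)%N -> E d, (l <= 2 * (D.+1 - s))%N & (l <= D)%N] &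
     [/\ few M (threshold p1 q1 : R) (4 * beta + 6)%N,
         p2 = 0%N \/ many M (threshold p2 q2 : R) (4 * beta - 26)%N,
         s1 = 0%N \/ many M (threshold p1 q1 : R) (2 * alpha - 5 - s1)%N,
         (s2 <= D)%N -> few M (threshold p2 q2 : R) (2 * alpha + 3 - s2)%N &
         many M (0 : R) l]].
  by exists p1, q1, p2, q2, M.
have large (c : R) : 0 < c -> \forall M \near \oo, 100 <= c * M%:R.
  move=> c0; near=> M; rewrite mulrC -ler_pdivrMr //.
  by near: M; exact: nbhs_infty_ger.
have large1 : \forall M \near \oo, th1 = 0 \/ 100 <= th1 * M%:R.
  have [th1_gt0|th1_le0] := ltP 0 th1; last first.
    have th1E : th1 = 0 by lra.
    by exists 0%N => // M _; left.
  by apply: filterS (large _ th1_gt0) => M; right.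
have large2 : \forall M \near \oo, th2 = a \/ 100 <= (th2 - 2 * b) * M%:R.
  case: up2 => [|[th2b _]]; first by exists 0%N => // M _; left.
  have c0 : 0 < th2 - 2 * b by lra.
  by apply: filterS (large _ c0) => M; right.
near=> M.
have x1 : 100 <= 1 * M%:R :> R by near: M; exact: large.
have xb : 100 <= b * M%:R by near: M; exact: large.
have xe : 100 <= e * M%:R by near: M; exact: large.
have xeta : 100 <= eta * M%:R by near: M; exact: large.
have xth1 : th1 = 0 \/ 100 <= th1 * M%:R by near: M.
have xth2 : th2 = a \/ 100 <= (th2 - 2 * b) * M%:R by near: M.
have M0 : (0 < M)%N by rewrite -(ltr0n R); lra.
set x := M%:R in x1 xb xe xeta xth1 xth2 *.
have x0 : 0 < x by move: x1; clear; lra.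
have th2x : th2 * x <= a * x by rewrite ler_wpM2r // ltW.
have abx : 2 * (b * x) <= a * x by rewrite mulrA ler_wpM2r // ltW.
have th12x : 0 <= th1 * x <= th2 * x.
  by rewrite mulr_ge0 ?(ltW x0) //= ler_wpM2r // ltW.
have xth1' : th1 * x = 0 \/ 100 <= th1 * x.
  by case: xth1 => [->|]; [left; rewrite mul0r|right].
have Hx : 2 * x + 4 * (eta * x) <= a * x - th2 * x + th1 * x \/
    (x + 2 * (eta * x) <= a * x - th2 * x /\ 2 * x + 4 * (eta * x) <= a * x).
  case: Heta => [h|[h1 h2]]; [left|right].
    by have := ler_wpM2r (ltW x0) h; clear; lra.
  by have := ler_wpM2r (ltW x0) h1; have := ler_wpM2r (ltW x0) h2; clear; split; lra.
have x100 : 100 <= x by move: x1; clear; lra.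
have := grid_bounds xb abx th12x th2x x100 xeta xth1' Hx.
have ax0 : 0 <= a * x by move: abx xb; clear; lra.
have bx0 : 0 <= b * x by move: xb; clear; lra.
have th1x0 : 0 <= th1 * x by case/andP: th12x.
have th2x0 : 0 <= th2 * x by case/andP: th12x => /le_trans; apply.
have lx0 : 0 <= 2 * x + 2 * (eta * x) by move: x1 xeta; clear; lra.
have [al1 al2] := truncn_bounds ax0; have [be1 be2] := truncn_bounds bx0.
have [A11 A12] := truncn_bounds th1x0; have [A21 A22] := truncn_bounds th2x0.
have [l1 l2] := truncn_bounds lx0.
have A2E : th2 = a -> Num.truncn (th2 * x) = Num.truncn (a * x) by move=> ->.
move: (Num.truncn (a * x)) (Num.truncn (b * x)) (Num.truncn (th1 * x)) (Num.truncn (th2 * x)) A2E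
  (Num.truncn (2 * x + 2 * (eta * x)))
  al1 al2 be1 be2 A11 A12 A21 A22 l1 l2.
move=> alpha beta A1 A2 A2E l al1 al2 be1 be2 A11 A12 A21 A22 l1 l2 /=.
move=> [ab_nat beta8 [A12_nat A2a] A1_cases l_nat].
have few1 : few M (threshold p1 q1 : R) (4 * beta + 6)%N.
  apply: up_rate_few up1 => //; rewrite -/x natrD natrM.
  by move: be1 xe; clear; lra.
have many2 : p2 = 0%N \/ many M (threshold p2 q2 : R) (4 * beta - 26)%N.
  case: low2 => [->|low2]; [by left|right].
  apply: low_rate_many low2 => //; rewrite -/x natrB; last by move: beta8; clear; lia.
  by rewrite natrM; move: be2 xe; clear; lra.
have manyl : many M (0 : R) l.+1.
  apply: low_rate_many (low_rate0 eta0) => //; rewrite -/x -natr1.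
  by move: l2; clear; lra.
have many1 : (A1 - 4)%N = 0%N \/
    many M (threshold p1 q1 : R) (2 * alpha - 5 - (A1 - 4))%N.
  case: A1_cases => [->|A16]; [by left|right].
  case: low1 => [th1E|low1].
    have : 6%:R <= A1%:R :> R by rewrite ler_nat.
    by move: A11; rewrite th1E mul0r; clear; lra.
  apply: low_rate_many low1 => //; rewrite -/x.
  have -> : (2 * alpha - 5 - (A1 - 4) = 2 * alpha - (A1 + 1))%N.
    by move: A16 A12_nat A2a; clear; lia.
  rewrite natrB; last by move: A16 A12_nat A2a; clear; lia.
  by rewrite natrM natrD; move: al2 A11 xe; clear; lra.
have [th2E|th2a'] := eqVneq th2 a.
  move: (A2E th2E) => {A2E}A2E.
  (* As [alpha + 3] exceeds D, no long distance is used. *)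
  exists (A1 - 4)%N, (alpha + 3)%N, l.+1; split; [by split| | | |].
  - by split => //; move: ab_nat beta8 A12_nat A2a; clear; lia.
  - by exists 0%N; move: l_nat A2E A1_cases; clear; lia.
  - left; apply: leq_trans (count_two_intervals _ _ _);
      move: l_nat A2E A1_cases A12_nat beta8 ab_nat; clear; lia.
  - by split => //; clear; lia.
have up2' : up_rate (threshold p2 q2) (a - th2 / 2 + e).
  by case: up2 => [F|[]//]; rewrite F eqxx in th2a'.
case: xth2 => [F|xth2]; first by rewrite F eqxx in th2a'.
have A2b : (2 * beta + 2 < A2.+1)%N.
  rewrite -(ltr_nat R) -natr1 natrD natrM.
  by move: xth2 be1 A22; clear; lra.
exists (A1 - 4)%N, A2.+1, l.+1; split; [by split| | | |].
- by split => //; move: ab_nat beta8 A12_nat A2a; clear; lia.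
(* Consecutive certified distances: 0 and 1 if short edges are used, otherwise the first two long
   ones. *)
- have [A16|A16] := leqP 6 A1; [exists 0%N|exists A2.+1];
    move: l_nat A1_cases A16 A2a; clear; lia.
- case: l_nat => [h|[h1 h2]]; [left|right].
    by apply: leq_trans (count_two_intervals _ _ _);
      move: h A1_cases A12_nat A2a beta8 ab_nat; clear; lia.
  by exists A2.+1; split => [d ->||]; [rewrite orbT|move: h1; clear; lia|move: h2; clear; lia].
- split => // _; apply: up_rate_few up2' => //; rewrite -/x.
  have -> : (2 * alpha + 3 - A2.+1 = 2 * alpha + 2 - A2)%N by clear; lia.
  rewrite natrB; last by move: A2a; clear; lia.
  by rewrite natrD natrM; move: al1 A22 xe; clear; lra.
Unshelve. all: by end_near. Qed.

(** * From positions to cells *)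

Lemma uniform_prob_cell (R : realType) K k : (k < K)%N ->
  uniform_prob (@ltr01 R) `[k%:R / K%:R, k.+1%:R / K%:R[ = (K%:R^-1)%:E.
Proof.
move=> kK; have K0 : 0 < K%:R :> R by rewrite ltr0n; lia.
rewrite /uniform_prob (eq_integral (cst 1%E)) => [|x].
  rewrite integral_cst ?mul1e; last exact: measurable_itv.
  rewrite [LHS]lebesgue_measure_itv /= lte_fin ltr_pM2r ?invr_gt0 // ltr_nat ltnSn.
  by rewrite -EFinB -mulrBl -natr1 addrAC subrr add0r mul1r.
rewrite inE /= in_itv /= => /andP[kx xk]; rewrite /uniform_pdf ifT ?subr0 ?invr1 //.
apply/andP; split; first by apply: le_trans kx; rewrite divr_ge0.
by apply: le_trans (ltW xk) _; rewrite ler_pdivrMr // mul1r ler_nat.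
Qed.

Lemma measurable_dL_le (R : realType) d (T : measurableType d)
  (f g : {mfun T >-> R}) (r : R) :
  measurable [set w | dL (f w) (g w) <= r].
Proof.
have mfg : measurable_fun setT (fun w => `|f w - g w|).
  by apply: measurableT_comp => //; apply: measurable_realfun.measurable_funB.
rewrite -[X in measurable X]setTI.
have /(_ measurableT [set true]) :
    measurable_fun setT (fun w => dL (f w) (g w) <= r).
  apply: measurable_realfun.measurable_fun_ler => //; rewrite /dL.
  by apply: measurable_realfun.measurable_minr => //; apply: measurable_realfun.measurable_funB.
by move=> /(_ I).
Qed.

Section Cells.
Context (R : realType) d (T : measurableType d) (P : probability T R).
Variables (n : nat) (X : 'I_n -> {RV P >-> R}).

(** The graph takes finitely many values, so the event is a finite union of finite intersections of
    edge conditions, whatever the property [Q]. *)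
Lemma measurable_gbm_event (Q : rel 'I_n -> Prop) (V1 : {set 'I_n}) rs rd :
  measurable [set w | Q (gbm V1 rs rd (fun u => X u w))].
Proof.
pose F (g : {ffun 'I_n * 'I_n -> bool}) :=
  \bigcap_(p in [set: 'I_n * 'I_n]) [set w | gbm V1 rs rd (fun u => X u w) p.1 p.2 = g p].
have -> : [set w | Q (gbm V1 rs rd (fun u => X u w))] =
    \bigcup_(g in [set g : {ffun 'I_n * 'I_n -> bool} | Q (fun u v => g (u, v))]) F g.
  apply/seteqP; split => [w Qw|w [g Qg Fg]].
    exists [ffun p => gbm V1 rs rd (fun u => X u w) p.1 p.2].
      rewrite /=; suff -> : (fun u v : 'I_n =>
        [ffun p => gbm V1 rs rd (fun u => X u w) p.1 p.2] (u, v)) =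
        gbm V1 rs rd (fun u => X u w) by [].
      by apply/funext => u; apply/funext => v; rewrite ffunE.
    by move=> p _; rewrite /= ffunE.
  rewrite /=; suff -> : gbm V1 rs rd (fun u => X u w) = (fun u v => g (u, v)) by [].
  by apply/funext => u; apply/funext => v; exact: (Fg (u, v) I).
apply: fin_bigcup_measurable; first exact: finite_finset.
move=> g _; apply: fin_bigcap_measurable; first exact: finite_finset.
move=> [u v] _ /=.
pose r := if (u \in V1) == (v \in V1) then rs else rd.
have mA : measurable [set w | dL (X u w) (X v w) <= r] by exact: measurable_dL_le.
rewrite /gbm -/r; have [uv|uv] := eqVneq u v.
  case: (g (u, v)) => /=.
    by rewrite (_ : [set w | _] = set0) //; apply/seteqP; split.
  by rewrite (_ : [set w | _] = setT) //; apply/seteqP; split.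
case: (g (u, v)) => //=.
rewrite (_ : [set w | _] = ~` [set w | dL (X u w) (X v w) <= r]).
  exact: measurableC.
by apply/seteqP; split => w /=; [move=> -> | move/negP/negbTE].
Qed.

Hypothesis X_iid : iid_uniform01 X.
Variable K : nat.
Hypothesis K_gt0 : (0 < K)%N.

Definition cell_event (c : {ffun 'I_n -> 'I_K}) : set T :=
  [set w | forall u, (c u)%:R / K%:R <= X u w < (c u).+1%:R / K%:R].

Lemma measurable_cell_event c : measurable (cell_event c).
Proof.
rewrite (_ : cell_event c = \bigcap_(u in [set: 'I_n])
   (X u @^-1` `[(c u)%:R / K%:R, (c u).+1%:R / K%:R[)).
  apply: fin_bigcap_measurable; first exact: finite_finset.
  by move=> u _; rewrite -[X in measurable X]setTI; apply: measurable_funP.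
apply/seteqP; split => w H u; first by move=> _; rewrite /= in_itv /= H.
by have := H u I; rewrite /= in_itv.
Qed.

Lemma prob_cell_event c : P (cell_event c) = ((K ^ n)%:R^-1)%:E.
Proof.
have [indep unif] := X_iid.
pose B u : set R := `[(c u)%:R / K%:R, (c u).+1%:R / K%:R[%classic.
have mB u : measurable (B u) by exact: measurable_itv.
have := indep [set: 'I_n]%SET B mB.
rewrite (_ : [set w | _] = cell_event c); last first.
  apply/seteqP; split => w /= H u; last by move=> _; rewrite /B /= in_itv /= H.
  by have := H u (finset.in_setT _); rewrite /B /= in_itv.
move=> ->; congr EFin.
rewrite (eq_bigr (fun=> K%:R^-1)) => [|u _]; last first.
  have := unif u (B u) (mB u); rewrite /distribution /pushforward /= => ->.
  by rewrite uniform_prob_cell.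
by rewrite prodr_const cardsT card_ord natrX exprVn.
Qed.

Lemma cell_event_disjoint c c' : c != c' -> cell_event c `&` cell_event c' = set0.
Proof.
move=> /eqP cc'; apply/seteqP; split => // w [/= H H']; apply: cc'.
apply/ffunP => u; apply: val_inj => /=.
have K0 : 0 < K%:R :> R by rewrite ltr0n.
have /andP[h1 h2] := H u; have /andP[h1' h2'] := H' u.
have := le_lt_trans h1 h2'; have := le_lt_trans h1' h2.
by rewrite !ltr_pM2r ?invr_gt0 // !ltr_nat; lia.
Qed.

(** The events of distinct cell functions are disjoint and equiprobable. They miss the position 1,
    but a lower bound needs no covering. *)
Lemma prob_cells_ge (S : {set {ffun 'I_n -> 'I_K}}) (A : set T) :
  measurable A -> (forall c, c \in S -> cell_event c `<=` A) ->
  ((proportion R S)%:E <= P A)%E.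
Proof.
move=> mA SA; pose U s := \big[setU/set0]_(c <- s) cell_event c.
have mU s : measurable (U s).
  by apply: bigsetU_measurable => c _; exact: measurable_cell_event.
have PU s : uniq s -> P (U s) = ((size s)%:R / (K ^ n)%:R)%:E.
  elim: s => [|c s IH] /=; first by rewrite /U big_nil measure0 mul0r.
  move=> /andP[cs us]; rewrite /U big_cons measureU //; first last.
  - apply/seteqP; split => // w [cw]; rewrite -bigcup_seq => -[c' /= c's c'w].
    have cc' : c != c' by apply: contraNneq cs => ->.
    by have := cell_event_disjoint cc'; rewrite -subset0 => /(_ w); apply.
  - exact: mU.
  - exact: measurable_cell_event.
  rewrite [X in (_ + X)%E](IH us) [X in (X + _)%E](prob_cell_event c) -EFinD; congr EFin.
  by rewrite -natr1 mulrDl mul1r addrC.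
rewrite /proportion cardE -PU ?enum_uniq //.
apply: le_measure; rewrite ?inE //.
rewrite /U -bigcup_seq => w [c]; rewrite /= mem_enum => cS cw; exact: SA cw.
Qed.

End Cells.

(** The difference of two positions differs from that of their cells by less than one cell, and
    taking the shorter arc preserves this error. *)
Lemma dL_cell_dist (R : realType) K k l (x y : R) : (k < K)%N -> (l < K)%N ->
  k%:R / K%:R <= x < k.+1%:R / K%:R -> l%:R / K%:R <= y < l.+1%:R / K%:R ->
  `|K%:R * dL x y - (cell_dist K k l)%:R| <= 1.
Proof.
wlog kl : k l x y / (k <= l)%N.
  move=> H kK lK xk yl; have [kl|/ltnW lk] := leqP k l; first exact: H.
  by rewrite cell_distC /dL (distrC x); exact: H.
move=> kK lK; have K0 : 0 < K%:R :> R by rewrite ltr0n; lia.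
rewrite !ler_pdivrMr // !ltr_pdivlMr // -!natr1 => /andP[xk kx] /andP[yl ly].
have -> : cell_dist K k l = minn (l - k) (K - (l - k)).
  rewrite /cell_dist; have := offset_cases K k l; have := offset_cases K l k; lia.
have kl1 : k = l \/ k%:R + 1 <= l%:R :> R.
  have [->|kl'] := eqVneq k l; [by left|right].
  by rewrite natr1 ler_nat; lia.
have -> : (minn (l - k) (K - (l - k)))%:R = Num.min (l%:R - k%:R) (K%:R - (l%:R - k%:R)) :> R.
  rewrite natr_min !natrB //; lia.
have Ky : K%:R * y = y * K%:R by rewrite mulrC.
have Kx : K%:R * x = x * K%:R by rewrite mulrC.
have xy : `|K%:R * `|x - y| - (l%:R - k%:R)| <= 1.
  have [xy|xy] := leP x y.
    by rewrite (distrC x) (ger0_norm (_ : 0 <= y - x)) ?subr_ge0 // ler_norml; lra.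
  have xy0 : 0 <= x - y by rewrite subr_ge0 ltW.
  rewrite (ger0_norm xy0).
  have xyK : y * K%:R < x * K%:R by rewrite ltr_pM2r.
  (* As x > y while k <= l, both points are in the same cell. *)
  by case: kl1 => [kl'|kl']; [subst l|]; rewrite ler_norml; lra.
rewrite /dL; move: `|x - y| xy => t; rewrite !ler_norml => H.
have [h|h] := leP t (1 - t);
  have [h'|h'] := leP (l%:R - k%:R : R) (K%:R - (l%:R - k%:R)).
- by have := ler_wpM2l (ltW K0) h; lra.
- by have := ler_wpM2l (ltW K0) h; lra.
- by have := ler_wpM2l (ltW K0) (ltW h); lra.
- by have := ler_wpM2l (ltW K0) (ltW h); lra.
Qed.

(** * Events of probability tending to one *)

Section Mostly.
Context {R : realType}.
Variable M : nat.
Hypothesis M_gt0 : (0 < M)%N.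
Local Notation num_cells m := (@num_cells R M m).

Definition mostly (Q : forall m, {set 'I_(m.*2)} ->
    {ffun 'I_(m.*2) -> 'I_(num_cells m)} -> Prop) :=
  forall eps : R, 0 < eps -> \forall m \near \oo,
    forall V1 : {set 'I_(m.*2)}, #|V1| = m ->
    exists2 B, proportion R B <= eps & forall c, c \notin B -> Q m V1 c.

Lemma mostly_and Q Q' : mostly Q -> mostly Q' ->
  mostly (fun m V1 c => Q m V1 c /\ Q' m V1 c).
Proof.
move=> HQ HQ' eps e0; have e20 : 0 < eps / 2 by lra.
apply: filterS2 (HQ _ e20) (HQ' _ e20) => m H H' V1 cV.
have [B Be BQ] := H _ cV; have [B' Be' BQ'] := H' _ cV.
exists (B :|: B')%SET.
  apply: (@le_trans _ _ (proportion R B + proportion R B')); last by lra.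
  rewrite /proportion -mulrDl ler_wpM2r ?invr_ge0 // -natrD ler_nat.
  exact: leq_card_setU.
by move=> c; rewrite inE negb_or => /andP[cB cB']; split; [exact: BQ|exact: BQ'].
Qed.

Let ln2_gt0 : 0 < ln 2 :> R. Proof. by rewrite ln_gt0 // ltr1n. Qed.

Lemma ln_up_log n : (1 < n)%N ->
  ln (n%:R : R) <= (up_log 2 n)%:R * ln 2 <= ln (n%:R : R) + ln 2.
Proof.
move=> n1; have n0 : 0 < n%:R :> R by rewrite ltr0n; lia.
have lnX k : k%:R * ln 2 = ln (2 ^ k)%:R :> R.
  by rewrite natrX lnXn // mulr_natl.
have L0 : (0 < up_log 2 n)%N.
  by rewrite up_log_gt0; lia.
apply/andP; split.
  rewrite lnX ler_ln ?posrE // ?ltr0n ?expn_gt0 // ler_nat.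
  exact: (@up_logP 2).
have -> : (up_log 2 n)%:R = (up_log 2 n).-1%:R + 1 :> R by rewrite natr1 prednK.
rewrite mulrDl mul1r lerD2r lnX ler_ln ?posrE // ?ltr0n ?expn_gt0 // ler_nat.
exact/ltnW/(@up_log_gtn 2).
Qed.

Lemma mostly_few (W p q s0 : nat) : (0 < q)%N -> few M (threshold p q : R) s0 ->
  mostly (fun m V1 c => forall i r1 r0, window (num_cells m) W i r1 r0 ->
    (size r1 + size r0 <= s0)%N ->
    (q * hit_count V1 c i r1 r0 < p * up_log 2 m.*2)%N).
Proof.
move=> q0 [lam [l0 [delta [rho [d0 r1 H]]]]] eps e0.
have near_bad := bad_vanish (cond := fun s => (s <= s0)%N) M_gt0 W 0 d0 r1 e0 H.
near=> m => V1 cV.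
have m1 : (0 < m)%N by near: m; exact: nbhs_infty_ge.
have Hm : forall V1 : {set 'I_(m.*2)}, #|V1| = m ->
    proportion R (bad (num_cells m) V1 W lam
      (threshold p q * ln (m.*2)%:R + 0) (fun s => s <= s0)%N) <= eps.
  by near: m.
eexists; first exact: Hm cV.
move=> c; rewrite inE => /asboolPn nb i r1' r0 win sz; rewrite ltnNge; apply/negP => le_hits.
apply: nb; exists i, r1', r0; split => //; rewrite addr0; apply: ler_wpM2l => //.
have /andP[lnL _] : ln ((m.*2)%:R : R) <= (up_log 2 m.*2)%:R * ln 2 <=
    ln ((m.*2)%:R : R) + ln 2.
  by apply: ln_up_log; lia.
have qR : 0 < q%:R :> R by rewrite ltr0n.
have l2 := ln2_gt0.
rewrite /threshold mulrAC ler_pdivrMr ?mulr_gt0 //.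
apply: (@le_trans _ _ (p%:R * ((up_log 2 m.*2)%:R * ln 2))); first by rewrite ler_wpM2l.
by rewrite mulrA [leRHS]mulrA ler_pM2r // -!natrM ler_nat [leqRHS]mulnC.
Unshelve. all: by end_near. Qed.

Lemma mostly_many (W p q s0 : nat) : (0 < q)%N -> many M (threshold p q : R) s0 ->
  mostly (fun m V1 c => forall i r1 r0, window (num_cells m) W i r1 r0 ->
    (s0 <= size r1 + size r0)%N ->
    (p * up_log 2 m.*2 < q * (hit_count V1 c i r1 r0 - 2))%N).
Proof.
move=> q0 [lam [l0 [delta [rho [d0 r1 H]]]]] eps e0.
(* The term p / q pays for the rounding in [up_log], and 2 for the two endpoints removed from the
   hits. *)
pose C : R := p%:R / q%:R + 2.
have near_bad := bad_vanish (cond := fun s => (s0 <= s)%N) M_gt0 W C d0 r1 e0 H.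
near=> m => V1 cV.
have m1 : (0 < m)%N by near: m; exact: nbhs_infty_ge.
have Hm : forall V1 : {set 'I_(m.*2)}, #|V1| = m ->
    proportion R (bad (num_cells m) V1 W lam
      (threshold p q * ln (m.*2)%:R + C) (fun s => s0 <= s)%N) <= eps.
  by near: m.
eexists; first exact: Hm cV.
move=> c; rewrite inE => /asboolPn nb i r1' r0 win sz; rewrite ltnNge; apply/negP => le_hits.
apply: nb; exists i, r1', r0; split => //; apply: ler_wnM2l => //.
have /andP[_ lnL] : ln ((m.*2)%:R : R) <= (up_log 2 m.*2)%:R * ln 2 <=
    ln ((m.*2)%:R : R) + ln 2.
  by apply: ln_up_log; lia.
have qR : 0 < q%:R :> R by rewrite ltr0n.
have l2 := ln2_gt0.
set N := hit_count _ _ _ _ _ in le_hits *.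
have le_N : (q * N <= p * up_log 2 m.*2 + 2 * q)%N by nia.
have H0 : q%:R * N%:R <= p%:R * (up_log 2 m.*2)%:R + 2 * q%:R :> R.
  by rewrite -!natrM -natrD ler_nat.
have {H0}H1 := ler_wpM2r (ltW l2) H0.
have H2 := ler_wpM2l (ler0n R p) lnL.
have -> : threshold p q * ln (m.*2)%:R + C =
    (p%:R * (ln (m.*2)%:R + ln 2) + 2 * q%:R * ln 2) / (q%:R * ln 2).
  by rewrite /threshold /C; field; rewrite !gt_eqF.
rewrite ler_pdivlMr ?mulr_gt0 //; lra.
Unshelve. all: by end_near. Qed.

End Mostly.

Lemma mostly_true (R : realType) M Q :
  (forall m V1 c, Q m V1 c) -> @mostly R M Q.
Proof.
move=> HQ eps e0; exists 0%N => // m _ V1 _; exists finset.set0 => [|c _]; last exact: HQ.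
by rewrite /proportion cards0 mul0r ltW.
Qed.

Lemma gbm_simple (R : realType) n (V1 : {set 'I_n}) (rs rd : R) x :
  simple_graph (gbm V1 rs rd x).
Proof.
split=> [u v|u]; last by rewrite /gbm eqxx.
by rewrite /gbm eq_sym /dL distrC (eq_sym (u \in V1)).
Qed.

Lemma connected_parts_recover p1 q1 p2 q2 n (V1 : {set 'I_n})
    (e : rel 'I_n) : (0 < n)%N -> simple_graph e ->
  (forall u v, connect (certificate p1 q1 p2 q2 e) u v =
     ((u \in V1) == (v \in V1))) ->
  recovers (recovery p1 q1 p2 q2) e V1.
Proof.
move=> n0 es H; have [m [t [pm Hm]]] :=
  recovery_correct p1 q1 p2 q2 es (erefl : val (Ordinal n0) = 0%N).
exists m, t; split => //=.
have [root1|root1] := boolP (Ordinal n0 \in V1); [left|right].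
  by apply/setP => i; rewrite inE Hm H root1.
by apply/setP => i; rewrite !inE Hm H (negbTE root1); case: (i \in V1).
Qed.

Section Geometry.
Context {R : realType}.
Variables (n K : nat) (V1 : {set 'I_n}) (rs rd A B : R).
Variables (c : 'I_n -> nat) (x : 'I_n -> R).
Hypothesis K_gt0 : (0 < K)%N.
Hypothesis c_lt : forall u, (c u < K)%N.
Hypothesis x_cell : forall u, (c u)%:R / K%:R <= x u < (c u).+1%:R / K%:R.
Hypotheses (A_ge0 : 0 <= A) (B_ge0 : 0 <= B).
Hypothesis Krs : A - 1 <= K%:R * rs <= A.
Hypothesis Krd : B - 1 <= K%:R * rd <= B.
Local Notation dist u v := (cell_dist K (c u) (c v)).

(** One cell is lost in rounding the positions and at most one in [K * r]. *)
Lemma near_dL u v r C : 0 <= C -> C - 1 <= K%:R * r ->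
  (dist u v + 3 <= Num.truncn C)%N -> dL (x u) (x v) <= r.
Proof.
move=> C0 Cr duv; have K0 : 0 < K%:R :> R by rewrite ltr0n.
have := dL_cell_dist (c_lt u) (c_lt v) (x_cell u) (x_cell v).
have [tC _] := truncn_bounds C0.
have H : (dist u v)%:R + 3 <= (Num.truncn C)%:R :> R by rewrite -natrD ler_nat.
by rewrite ler_norml => Hd; rewrite -(ler_pM2l K0); lra.
Qed.

Lemma far_dL u v r C : 0 <= C -> K%:R * r <= C -> dL (x u) (x v) <= r ->
  (dist u v <= (Num.truncn C).+1)%N.
Proof.
move=> C0 Cr; have K0 : 0 < K%:R :> R by rewrite ltr0n.
have := dL_cell_dist (c_lt u) (c_lt v) (x_cell u) (x_cell v).
have [_ tC] := truncn_bounds C0.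
have tE : (Num.truncn C).+2%:R = (Num.truncn C)%:R + 1 + 1 :> R by rewrite !natr1.
rewrite ler_norml => Hd; rewrite -(ler_pM2l K0) => Hr.
by rewrite -ltnS -(ltr_nat R) tE; lra.
Qed.

End Geometry.

Lemma near_radii (R : realType) (M : nat) (a b : R) :
  (0 < M)%N -> 0 < b <= a -> \forall m \near \oo,
  let n : R := (m.*2)%:R in let K := @num_cells R M m in
  a * M%:R - 1 <= K%:R * (a * ln n / n) <= a * M%:R /\
  b * M%:R - 1 <= K%:R * (b * ln n / n) <= b * M%:R.
Proof.
move=> M0 /andP[b0 ba]; have a0 : 0 < a by apply: lt_le_trans ba.
have MR : 0 < M%:R :> R by rewrite ltr0n.
have aM : 0 < a * M%:R by rewrite mulr_gt0.
(* A relative error of 1 / (a M) is at most one cell on radii of at most a M cells. *)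
have d0 : 0 < (a * M%:R)^-1 by rewrite invr_gt0.
apply: filterS (near_cells M0 0 d0) => m [l1 _ K0 m0 /andP[Kl Ku]] /=.
set n : R := (m.*2)%:R in l1 Kl Ku *; set K := num_cells M m in K0 Kl Ku *.
have n0 : 0 < n by rewrite /n ltr0n double_gt0.
have H c : 0 < c <= a -> c * M%:R - 1 <= K%:R * (c * ln n / n) <= c * M%:R.
  move=> /andP[c0 ca].
  have -> : K%:R * (c * ln n / n) = c * (K%:R * ln n) / n by field; rewrite gt_eqF.
  have up := ler_wpM2l (ltW c0) Kl.
  apply/andP; split; last by rewrite ler_pdivrMr // -mulrA.
  rewrite ler_pdivlMr // mulrBl mul1r.
  have := ler_wpM2l (ltW c0) Ku; rewrite mulrDl mul1r mulrDl mulrDr.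
  have : c * ((a * M%:R)^-1 * K%:R * ln n) <= n.
    have -> : c * ((a * M%:R)^-1 * K%:R * ln n) = c * (K%:R * ln n) / (a * M%:R).
      by field; rewrite !gt_eqF.
    rewrite ler_pdivrMr //; apply: le_trans up _.
    rewrite [leRHS]mulrC -mulrA; apply: ler_wpM2r ca.
    by rewrite mulr_ge0 ?ltW.
  lra.
by split; apply: H; rewrite ?a0 ?b0 //=.
Qed.

(** * Recovery with high probability *)

Section Recovers.
Context {R : realType}.
Variables (a b : R) (p1 q1 p2 q2 M s1 s2 l : nat).
Hypotheses (b_gt0 : 0 < b) (ab : 2 * b <= a).
Let alpha := Num.truncn (a * M%:R).
Let beta := Num.truncn (b * M%:R).
Let D := (alpha - 3)%N.
Let E := fun d => ((d < s1) || (s2 <= d <= D))%N.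
(** The sum of the two lengths required of a window; it does not depend on n, so the union bound
    only loses a constant factor on subsets. *)
Let W := (4 * alpha + 10 + (2 * (l * (2 * D.+2)) + l.+1))%N.
Hypotheses (q1_gt0 : (0 < q1)%N) (q2_gt0 : (0 < q2)%N).
Hypotheses (M_gt0 : (0 < M)%N) (l_gt0 : (0 < l)%N).
Hypotheses (alpha_ge : (2 * beta <= alpha)%N) (beta_ge : (8 <= beta)%N).
Hypotheses (s1_le : (s1 + 2 <= alpha)%N) (s2_gt : (2 * beta + 2 < s2)%N).
Hypothesis E_succ : exists d, E d /\ E d.+1.
Hypothesis E_large : (l <= count E (iota 1 D))%N \/
  exists s, [/\ forall d, (s <= d <= D)%N -> E d, (l <= 2 * (D.+1 - s))%N & (l <= D)%N].
Hypothesis few1 : few M (threshold p1 q1 : R) (4 * beta + 6)%N.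
Hypothesis many2 : p2 = 0%N \/ many M (threshold p2 q2 : R) (4 * beta - 26)%N.
Hypothesis many1 : s1 = 0%N \/ many M (threshold p1 q1 : R) (2 * alpha - 5 - s1)%N.
Hypothesis few2 : (s2 <= D)%N -> few M (threshold p2 q2 : R) (2 * alpha + 3 - s2)%N.
Hypothesis many0 : many M (0 : R) l.

Let thresholds_hold := fun m (V1 : {set 'I_(m.*2)})
    (c : {ffun 'I_(m.*2) -> 'I_(@num_cells R M m)}) =>
  let L := up_log 2 m.*2 in
  forall i r1 r0, window (num_cells (R := R) M m) W i r1 r0 ->
  let s := (size r1 + size r0)%N in let N := hit_count V1 c i r1 r0 in
  [/\ (s <= 4 * beta + 6 -> q1 * N <= p1 * L)%N,
     (4 * beta - 26 <= s -> p2 * L <= q2 * (N - 2))%N,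
     (0 < s1 -> 2 * alpha - 5 - s1 <= s -> p1 * L < q1 * (N - 2))%N,
     (s2 <= D -> s <= 2 * alpha + 3 - s2 -> q2 * N < p2 * L)%N &
     (l <= s -> 0 < N)%N].

Lemma mostly_thresholds : @mostly R M thresholds_hold.
Proof.
have H1 := mostly_few M_gt0 W q1_gt0 few1.
have H2 : @mostly R M (fun m V1 c => forall i r1 r0,
    window (@num_cells R M m) W i r1 r0 -> (4 * beta - 26 <= size r1 + size r0)%N ->
    (p2 * up_log 2 m.*2 <= q2 * (hit_count V1 c i r1 r0 - 2))%N).
  case: many2 => [->|/(mostly_many M_gt0 W q2_gt0)].
    by apply: mostly_true => m V1 c i r1 r0 _ _; rewrite mul0n.
  move=> H eps /H; apply: filterS => m HV V1 /HV[B Be HB]; exists B => // c /HB Hc.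
  by move=> i r1 r0 w sz; apply/ltnW/Hc.
have H3 : @mostly R M (fun m V1 c => forall i r1 r0,
    window (@num_cells R M m) W i r1 r0 -> (0 < s1)%N ->
    (2 * alpha - 5 - s1 <= size r1 + size r0)%N ->
    (p1 * up_log 2 m.*2 < q1 * (hit_count V1 c i r1 r0 - 2))%N).
  case: many1 => [s10|/(mostly_many M_gt0 W q1_gt0)].
    by apply: mostly_true => m V1 c i r1 r0 _; rewrite s10.
  move=> H eps /H; apply: filterS => m HV V1 /HV[B Be HB]; exists B => // c /HB Hc.
  by move=> i r1 r0 w _; apply: Hc.
have H4 : @mostly R M (fun m V1 c => forall i r1 r0,
    window (@num_cells R M m) W i r1 r0 -> (s2 <= D)%N ->
    (size r1 + size r0 <= 2 * alpha + 3 - s2)%N ->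
    (q2 * hit_count V1 c i r1 r0 < p2 * up_log 2 m.*2)%N).
  have [/few2/(mostly_few M_gt0 W q2_gt0) H|s2D] := boolP (s2 <= D)%N; last first.
    by apply: mostly_true.
  move=> eps /H; apply: filterS => m HV V1 /HV[B Be HB]; exists B => // c /HB Hc.
  by move=> i r1 r0 w _; apply: Hc.
(* Occupancy is the case of threshold 0. *)
have many0' : many M (threshold 0 1 : R) l by rewrite /threshold mul0r.
have H5 := mostly_many M_gt0 W (isT : 0 < 1)%N many0'.
move=> eps e0.
have := mostly_and H1 (mostly_and H2 (mostly_and H3 (mostly_and H4 H5))) e0.
apply: filterS => m HV V1 /HV[B Be HB]; exists B => // c /HB[h1 [h2 [h3 [h4 h5]]]].
move=> i r1 r0 w; split.
- by move=> sz; apply/ltnW/h1.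
- exact: h2.
- exact: h3.
- exact: h4.
- by move=> /(h5 i r1 r0 w); rewrite mul0n mul1n subn_gt0; exact: leq_trans.
Qed.

(** The deterministic half: once the counts of a cell function are within their thresholds, every
    choice of positions in these cells leads to recovery. *)
Lemma near_recovers : \forall m \near \oo, forall V1 : {set 'I_(m.*2)},
  forall (c : {ffun 'I_(m.*2) -> 'I_(@num_cells R M m)}) (x : 'I_(m.*2) -> R),
  thresholds_hold V1 c ->
  (forall u, (c u)%:R / (@num_cells R M m)%:R <= x u
     < (c u).+1%:R / (@num_cells R M m)%:R) ->
  recovers (recovery p1 q1 p2 q2)
    (gbm V1 (a * ln (m.*2)%:R / (m.*2)%:R) (b * ln (m.*2)%:R / (m.*2)%:R) x) V1.
Proof.
have b0 := b_gt0; have ab' := ab.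
have ba : 0 < b <= a by lra.
have aM : 0 <= a * M%:R by rewrite mulr_ge0 //; lra.
have bM : 0 <= b * M%:R by rewrite mulr_ge0 //; lra.
apply: filterS2 (near_radii M_gt0 ba) (near_cells M_gt0 (2 * W)%N (ltr01 : 0 < 1 :> R)).
move=> m /= [/andP[rs1 rs2] /andP[rd1 rd2]] [_ WK K0 m0 _] V1 c x Hc Hx.
set rs := a * _ / _ in rs1 rs2 *; set rd := b * _ / _ in rd1 rd2 *.
set e := gbm V1 rs rd x.
have es : simple_graph e by exact: gbm_simple.
have cK u : (c u < @num_cells R M m)%N by [].
apply: connected_parts_recover => //; first by rewrite double_gt0.
apply: (@certificate_components _ V1 e (@num_cells R M m) W (fun u => val (c u)) p1 q1 p2 q2
  alpha beta s1 s2 l) => //.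
- exact: es.1.
- move=> u v uv suv duv; rewrite /e /gbm uv suv /=.
  exact: (near_dL K0 cK Hx aM rs1 duv).
- move=> u v suv; rewrite /e /gbm suv => /andP[_].
  exact: (far_dL K0 cK Hx aM rs2).
- move=> u v suv duv; rewrite /e /gbm (negbTE suv).
  rewrite (near_dL K0 cK Hx bM rd1 duv) andbT.
  by apply: contra suv => /eqP ->.
- move=> u v suv; rewrite /e /gbm (negbTE suv) => /andP[_].
  exact: (far_dL K0 cK Hx bM rd2).
- by rewrite /W; clear; lia.
- by rewrite /W; clear; lia.
- by move=> i r1 r0 w; case: (Hc i r1 r0 w).
- by move=> i r1 r0 w; case: (Hc i r1 r0 w).
- by move=> i r1 r0 s10 w; case: (Hc i r1 r0 w) => _ _ H _ _; exact: H.
- by move=> i r1 r0 s2D w; case: (Hc i r1 r0 w) => _ _ _ H _; exact: H.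
- by move=> i r1 r0 w; case: (Hc i r1 r0 w).
Qed.

End Recovers.

Lemma proportion_setC (R : realType) n K (B : {set {ffun 'I_n -> 'I_K}}) :
  (0 < K)%N -> proportion R (~: B)%SET = 1 - proportion R B.
Proof.
move=> K0; have Kn : (K ^ n)%:R != 0 :> R by rewrite pnatr_eq0 expn_eq0; lia.
suff <- : proportion R (~: B)%SET + proportion R B = 1 by rewrite addrK.
rewrite /proportion -mulrDl -natrD.
have -> : (#|(~: B)%SET| + #|B| = K ^ n)%N.
  by rewrite addnC cardsC card_ffun !card_ord.
by rewrite divff.
Qed.

Theorem theorem4 (R : realType) (a b : R) (b_gt0 : 0 < b) (ab : 2 * b <= a)
    (cond : a - theta2 a b + theta1 a b > 2 \/
            (a - theta2 a b > 1 /\ a > 2)) :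
  exists p : program, polynomial_time p /\
    forall (d : nat -> measure_display)
           (Omega : forall m : nat, measurableType (d m))
           (P : forall m : nat, probability (Omega m) R)
           (X : forall m : nat, 'I_(m.*2) -> {RV (P m) >-> R})
           (V1 : forall m : nat, {set 'I_(m.*2)}),
      (forall m : nat, iid_uniform01 (X m)) ->
      (forall m : nat, #|V1 m| = m) ->
      (fun m : nat =>
         let n : R := (m.*2)%:R in
         let rs := a * ln n / n in
         let rd := b * ln n / n in
         P m [set w | recovers p (gbm (V1 m) rs rd (fun u => X m u w)) (V1 m)])
        @ \oo --> 1%E.
Proof.
have [p1 [q1 [p2 [q2 [M [s1 [s2 [l]]]]]]]] := constants b_gt0 ab cond.
move=> [[q10 q20 M0 l0] [alb be8 s1le s2gt] Es El [few1 many2 many1 few2 many0]].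
exists (recovery p1 q1 p2 q2); split; first exact: recovery_polynomial.
move=> d Omega P X V1 iid cV.
pose A m := [set w | recovers (recovery p1 q1 p2 q2)
  (gbm (V1 m) (a * ln (m.*2)%:R / (m.*2)%:R) (b * ln (m.*2)%:R / (m.*2)%:R)
    (fun u => X m u w)) (V1 m)].
have mA m : measurable (A m).
  exact: (measurable_gbm_event (X m)
    (fun e => recovers (recovery p1 q1 p2 q2) e (V1 m))).
apply/fine_cvgP; split.
  by exists 0%N => // m _; apply: fin_num_measure; exact: mA.
apply/cvgrPdist_le => eps e0.
have good := near_recovers p1 q1 p2 q2 b_gt0 ab M0 l0 alb be8 s1le s2gt Es El.
have most := mostly_thresholds q10 q20 M0 few1 many2 many1 few2 many0 e0.
have cells := near_cells (R := R) M0 0 (ltr01 : 0 < 1 :> R).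
apply: filterS3 good most cells => m good /(_ _ (cV m))[B Be HB] [_ _ K0 _ _].
rewrite /= -/(A m).
(* Success contains the cell events of all functions outside the exceptional set [B], whose
   proportion is at most eps. *)
have := prob_cells_ge (iid m) K0 (mA m) (S := (~: B)%SET) _.
rewrite proportion_setC // => PA.
have {}PA : ((1 - proportion R B)%:E <= P m (A m))%E.
  apply: PA => c; rewrite inE => /HB Hc w cw; exact: good Hc cw.
have PA1 := probability_le1 (P m) (mA m).
have := fin_num_measure (P m) _ (mA m).
move: (P m (A m)) PA PA1 => [r| |] //=; rewrite !lee_fin => r1 r2 _.
by rewrite ler_norml; lra.
Qed.
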